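(* Let $\mathfrak{b}(n)$ be defined by $$\sum_{n\ge 0}\mathfrak{b}(n)q^n=\beta(q):=\sum_{n\ge 0}\frac{q^{n(n+1)}(-q^2;q^2)_n}{(q;q^2)_{n+1}^2}.$$ Then for all integers $\alpha\ge 1$ and $n\ge 0$, $$\mathfrak{b}\left(2\cdot 3^{2\alpha-1}n+\frac{3^{2\alpha}-1}{2}\right)\equiv 0 \pmod{3^{2\alpha}}.$$
   Context: For $a$ and a variable $q$, $(a;q)_n=\prod_{k=0}^{n-1}(1-aq^k)$ and $(a;q)_\infty=\prod_{k\ge0}(1-aq^k)$. The series $\beta(q)$ (a second order mock theta function) is regarded as a formal power series in $q$ with integer coefficients. *)

(* Defs.v *)
From mathcomp Require Import all_boot all_order all_algebra.
Set Implicit Arguments. Unset Strict Implicit. Unset Printing Implicit Defensive.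
Import Order.TTheory GRing.Theory Num.Theory.
Local Open Scope ring_scope.

(* Formal power series in q with integer coefficients, as coefficient sequences. *)
Definition series := nat -> int.

Definition smul (f g : series) : series :=
  fun n => \sum_(i < n.+1) f i * g (n - i)%N.

Definition sone : series := fun n => (n == 0%N)%:R.

Definition sxpow (m : nat) : series := fun n => (n == m)%:R.

Definition sonePlus (m : nat) : series := fun n => (n == 0%N)%:R + (n == m)%:R.

(* 1 / (1 - q^m) for m > 0: the geometric series sum_{j>=0} q^{m j}. *)
Definition sgeomInv (m : nat) : series := fun n => (m %| n)%:R.

Definition sprod (k : nat) (F : nat -> series) : series :=
  foldr (fun j acc => smul (F j) acc) sone (iota 0 k).

Definition poch_mq2 (k : nat) : series := sprod k (fun j => sonePlus (2 * j + 2)).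

Definition inv_poch_q (k : nat) : series := sprod k (fun j => sgeomInv (2 * j + 1)).

Definition beta_term (k : nat) : series :=
  smul (sxpow (k * k.+1)) (smul (poch_mq2 k) (smul (inv_poch_q k.+1) (inv_poch_q k.+1))).

(* Coefficient of q^n in beta(q) = sum_{k>=0} beta_term k; the k-th term is
   O(q^{k(k+1)}), so only k <= n contribute to the coefficient of q^n. *)
Definition frak_b (n : nat) : int := \sum_(k < n.+1) beta_term k n.

(* Main.v *)
Require Import Defs.
From HB Require Import structures.
From mathcomp Require Import all_boot all_order all_algebra.
From mathcomp Require Import boolp ring zify.
Set Implicit Arguments. Unset Strict Implicit. Unset Printing Implicit Defensive.
Import Order.TTheory GRing.Theory Num.Theory.
Local Open Scope ring_scope.

(** All arguments [2 * 3^(2 alpha - 1) n + (3^(2 alpha) - 1)/2] are even, so only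
    [E(x) = sum b(2n) x^n] matters.  A Bailey-pair expansion of [1/(q;q^2)_{n+1}^2]
    together with a telescoping summation gives [E = psi(x)^2 / phi(-x)].

    Let [U_r] extract the coefficients of index [3n + r]; the numbers in question
    are the coefficients of [U_2 (U_0 U_2)^(alpha - 1) E].  Put
    [t = (phi(-x^3) / phi(-x))^4].  The 3-dissection
    [phi(-x) = phi(-x^9) - 2 x b(x^3)] and the norm identity
    [phi(-x^3) (phi(-x^3)^3 - 8 x b(x)^3) = phi(-x)^4] show that
    [w = phi(-x^9) / phi(-x)] is a root of [w^3 = t(x^3) (3 w^2 - 3 w + 1)].  Hence
    [U_2 (E t^i)] is [E(x^3)] times an integer polynomial in [t], and
    [U_0 (E(x^3) t^i)] is [E] times one, both given by the same third-order linear
    recurrence.  The recurrence bounds the 3-adic valuations of the coefficients of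
    these polynomials from below, and each application of [U_0] then [U_2] gains a
    factor [9]. *)

(** * The ring of integer power series *)

(** A wrapper that can carry a ring structure. Its product is [smul] itself, so the series of the
    statement are transported by merely applying [Fps]. *)
Record fps := Fps {fcoef :> nat -> int}.

HB.instance Definition _ := gen_eqMixin fps.
HB.instance Definition _ := gen_choiceMixin fps.

Lemma fpsP (f g : fps) : (forall n, f n = g n) -> f = g.
Proof. by case: f => f; case: g => g /= H; congr Fps; apply: funext. Qed.

Definition fadd (f g : fps) : fps := Fps (fun n => f n + g n).
Definition fopp (f : fps) : fps := Fps (fun n => - f n).
Definition fzero : fps := Fps (fun _ => 0).
Definition fmul (f g : fps) : fps := Fps (smul f g).
Definition fone : fps := Fps sone.

Lemma faddA : associative fadd.
Proof. by move=> f g h; apply: fpsP => n /=; rewrite addrA. Qed.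
Lemma faddC : commutative fadd.
Proof. by move=> f g; apply: fpsP => n /=; rewrite addrC. Qed.
Lemma fadd0 : left_id fzero fadd.
Proof. by move=> f; apply: fpsP => n /=; rewrite add0r. Qed.
Lemma faddN : left_inverse fzero fopp fadd.
Proof. by move=> f; apply: fpsP => n /=; rewrite addNr. Qed.

HB.instance Definition _ := GRing.isZmodule.Build fps faddA faddC fadd0 faddN.

(** Coefficients of a product up to index [n] depend only on the truncations at [n]; associativity
    and commutativity are thereby inherited from [{poly int}]. *)
Definition trunc (n : nat) (f : fps) : {poly int} := \poly_(i < n.+1) f i.

Lemma coef_trunc n f i : (i <= n)%N -> (trunc n f)`_i = f i.
Proof. by move=> le_in; rewrite coef_poly ltnS le_in. Qed.

Lemma smul_trunc n (f g : fps) i :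
  (i <= n)%N -> smul f g i = (trunc n f * trunc n g)`_i.
Proof.
move=> le_in; rewrite coefM; apply: eq_bigr => j _.
by rewrite !coef_trunc //; have := ltn_ord j; lia.
Qed.

Lemma fmulA : associative fmul.
Proof.
move=> f g h; apply: fpsP => n /=.
transitivity ((trunc n f * trunc n g * trunc n h)`_n).
  rewrite -mulrA coefM; apply: eq_bigr => j _; rewrite coef_trunc; last by have := ltn_ord j; lia.
  by rewrite -smul_trunc // leq_subr.
rewrite coefM; apply: eq_bigr => j _; rewrite coef_trunc ?leq_subr //.
by rewrite /= -smul_trunc //; have := ltn_ord j; lia.
Qed.

Lemma fmulC : commutative fmul.
Proof.
by move=> f g; apply: fpsP => n /=; rewrite !(@smul_trunc n) // mulrC.
Qed.

Lemma fmul1 : left_id fone fmul.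
Proof.
move=> f; apply: fpsP => n /=; rewrite /smul big_ord_recl /= mul1r subn0.
by rewrite big1 ?addr0 // => i _; rewrite /sone /= mul0r.
Qed.

Lemma fmulDl : left_distributive fmul fadd.
Proof.
move=> f g h; apply: fpsP => n /=; rewrite /smul -big_split /=.
by apply: eq_bigr => i _; rewrite mulrDl.
Qed.

Lemma fone_neq0 : fone != fzero.
Proof. by apply/eqP => /(congr1 (fun f : fps => f 0%N)). Qed.

HB.instance Definition _ :=
  GRing.Zmodule_isComNzRing.Build fps fmulA fmulC fmul1 fmulDl fone_neq0.

Lemma fcoefD (f g : fps) n : (f + g) n = f n + g n. Proof. by []. Qed.
Lemma fcoefN (f : fps) n : (- f) n = - f n. Proof. by []. Qed.
Lemma fcoef0 n : (0 : fps) n = 0. Proof. by []. Qed.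
Lemma fcoef1 n : (1 : fps) n = (n == 0%N)%:R. Proof. by []. Qed.
Lemma fcoefM (f g : fps) n : (f * g) n = \sum_(i < n.+1) f i * g (n - i)%N.
Proof. by []. Qed.
Lemma fcoefM0 (f g : fps) : (f * g) 0%N = f 0%N * g 0%N.
Proof. by rewrite fcoefM big_ord_recl big_ord0 addr0. Qed.
Lemma fcoef_sum (I : Type) (r : seq I) (P : pred I) (F : I -> fps) n :
  (\sum_(i <- r | P i) F i) n = \sum_(i <- r | P i) F i n.
Proof. by elim/big_rec2: _ => [|i y1 y2 _ <-]. Qed.

Definition X : fps := Fps (sxpow 1).

Lemma fcoefXM (f : fps) n : (X * f) n = if n is n'.+1 then f n' else 0.
Proof.
case: n => [|n]; first by rewrite fcoefM0 mul0r.
rewrite fcoefM !big_ord_recl /= mul0r add0r mul1r subSS subn0 big1 ?addr0 //.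
by move=> i _; rewrite mul0r.
Qed.

Lemma fcoefXnM m (f : fps) n : (X ^+ m * f) n = if (n < m)%N then 0 else f (n - m)%N.
Proof.
elim: m n => [|m IHm] n; first by rewrite mul1r subn0.
by rewrite exprS -mulrA fcoefXM; case: n => [|n] //; rewrite IHm ltnS subSS.
Qed.

Lemma fcoefXn m n : (X ^+ m) n = (n == m)%:R.
Proof.
rewrite -[X ^+ m]mulr1 fcoefXnM fcoef1; case: ltnP; lia.
Qed.

Lemma fcoefX0 m : (0 < m)%N -> (X ^+ m) 0%N = 0.
Proof. by rewrite fcoefXn; case: m. Qed.

(** * Congruence modulo powers of the variable, and limits *)

Definition eqm (N : nat) (f g : fps) := forall n, (n < N)%N -> f n = g n.

Lemma eqm_sym N f g : eqm N f g -> eqm N g f.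
Proof. by move=> H n /H. Qed.
Lemma eqm_trans N g f h : eqm N f g -> eqm N g h -> eqm N f h.
Proof. by move=> H1 H2 n lt_n; rewrite H1 // H2. Qed.
Lemma eqmW M N f g : (M <= N)%N -> eqm N f g -> eqm M f g.
Proof. by move=> le_MN H n lt_n; apply: H; lia. Qed.
Lemma eqmD N f g f' g' : eqm N f f' -> eqm N g g' -> eqm N (f + g) (f' + g').
Proof. by move=> H1 H2 n lt_n; rewrite !fcoefD H1 // H2. Qed.
Lemma eqmN N f f' : eqm N f f' -> eqm N (- f) (- f').
Proof. by move=> H1 n lt_n; rewrite !fcoefN H1. Qed.
Lemma eqmM N f g f' g' : eqm N f f' -> eqm N g g' -> eqm N (f * g) (f' * g').
Proof.
move=> H1 H2 n lt_n; rewrite !fcoefM; apply: eq_bigr => i _.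
by have := ltn_ord i => lt_i; rewrite H1 ?H2 //; lia.
Qed.
Lemma eqmXM m N f g : eqm N f g -> eqm (m + N) (X ^+ m * f) (X ^+ m * g).
Proof.
by move=> H n lt_n; rewrite !fcoefXnM; case: ltnP => // le_mn; apply: H; lia.
Qed.
Lemma eqmX0 m f : eqm m (X ^+ m * f) 0.
Proof. by move=> n lt_n; rewrite fcoefXnM lt_n. Qed.
Lemma eqmXW m n f : (n <= m)%N -> eqm n (X ^+ m * f) 0.
Proof. by move=> le_nm; apply: (eqmW le_nm); apply: eqmX0. Qed.
Lemma eqm_sum (I : Type) (r : seq I) (P : pred I) (F G : I -> fps) N :
  (forall i, P i -> eqm N (F i) (G i)) ->
  eqm N (\sum_(i <- r | P i) F i) (\sum_(i <- r | P i) G i).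
Proof.
by move=> H n lt_n; rewrite !fcoef_sum; apply: eq_bigr => i Pi; apply: H.
Qed.
Lemma eqm_unique f g : (forall N, eqm N f g) -> f = g.
Proof. by move=> H; apply: fpsP => n; apply: (H n.+1). Qed.

Definition conv (s : nat -> fps) (f : fps) :=
  forall M, exists N, forall n, (N <= n)%N -> eqm M (s n) f.

Lemma conv_unique s f g : conv s f -> conv s g -> f = g.
Proof.
move=> Hf Hg; apply: eqm_unique => M.
have [N1 H1] := Hf M; have [N2 H2] := Hg M.
apply: (@eqm_trans M (s (maxn N1 N2))); first by apply/eqm_sym/H1/leq_maxl.
exact/H2/leq_maxr.
Qed.

Lemma conv_ext s s' f : (forall n, s n = s' n) -> conv s f -> conv s' f.
Proof. by move=> E H M; have [N HN] := H M; exists N => n /HN; rewrite E. Qed.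

Lemma conv_eqm s f : (forall n, eqm n (s n) f) -> conv s f.
Proof. by move=> H M; exists M => n le_Mn; apply: eqmW (H n). Qed.

Lemma conv_approx s s' f : (forall n, eqm n (s n) (s' n)) -> conv s f -> conv s' f.
Proof.
move=> E H M; have [N HN] := H M; exists (maxn M N) => n; rewrite geq_max => /andP[le_Mn le_Nn].
by apply: eqm_trans (HN _ le_Nn); apply/eqm_sym/(eqmW le_Mn).
Qed.

Lemma conv_const f : conv (fun=> f) f.
Proof. by move=> M; exists 0%N. Qed.

Lemma convM s t f g : conv s f -> conv t g -> conv (fun n => s n * t n) (f * g).
Proof.
move=> Hf Hg M; have [N1 H1] := Hf M; have [N2 H2] := Hg M.
exists (maxn N1 N2) => n; rewrite geq_max => /andP[le1 le2].
by apply: eqmM; [apply: H1|apply: H2].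
Qed.

Lemma convD s t f g : conv s f -> conv t g -> conv (fun n => s n + t n) (f + g).
Proof.
move=> Hf Hg M; have [N1 H1] := Hf M; have [N2 H2] := Hg M.
exists (maxn N1 N2) => n; rewrite geq_max => /andP[le1 le2].
by apply: eqmD; [apply: H1|apply: H2].
Qed.

Lemma convX s f k : conv s f -> conv (fun n => s n ^+ k) (f ^+ k).
Proof.
move=> H; elim: k => [|k IHk]; first exact: conv_const.
by apply: (@conv_ext (fun n => s n * s n ^+ k)); [move=> n; rewrite exprS|rewrite exprS; apply: convM].
Qed.

Lemma conv_sub s f (k : nat -> nat) :
  (forall n, (n <= k n)%N) -> conv s f -> conv (fun n => s (k n)) f.
Proof.
move=> Hk H M; have [N HN] := H M; exists N => n le_Nn; apply: (HN (k n)).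
exact: leq_trans (Hk n).
Qed.

(** Coefficient [n] is read in [s n.+1], where it is already final if consecutive terms agree as in
    [flim_eqm]. *)
Definition flim (s : nat -> fps) : fps := Fps (fun n => s n.+1 n).

Lemma flim_eqm s n : (forall n, eqm n (s n) (s n.+1)) -> eqm n (s n) (flim s).
Proof.
move=> H m lt_mn /=.
have H' p k : eqm p (s p) (s (p + k)%N).
  elim: k => [|k IHk]; first by rewrite addn0.
  by apply: eqm_trans IHk _; rewrite addnS; apply: eqmW (H _); lia.
by rewrite -(subnKC lt_mn) -H'.
Qed.

Lemma flimP s : (forall n, eqm n (s n) (s n.+1)) -> conv s (flim s).
Proof. by move=> H; apply: conv_eqm => n; apply: flim_eqm. Qed.

(** * Inverses of series with constant term one *)

(** The geometric series in [1 - f], an inverse of [f] when the constant term is one. *)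
Definition fpsV (f : fps) : fps :=
  flim (fun n => \sum_(i < n) (1 - f) ^+ i).

Lemma eqm_pow (f : fps) n : f 0%N = 0 -> eqm n (f ^+ n) 0.
Proof.
move=> f0; elim: n => [|n IHn] // m lt_mn.
rewrite exprS fcoefM big1 ?fcoef0 // => i _.
case: (posnP i) => [->|i_gt0]; first by rewrite f0 mul0r.
by have := ltn_ord i => lt_i; rewrite IHn ?mulr0 //; lia.
Qed.

Lemma mulfVx (f : fps) : f 0%N = 1 -> f * fpsV f = 1.
Proof.
move=> f0; have g0 : (1 - f) 0%N = 0 by rewrite fcoefD fcoefN f0.
have C : conv (fun n => \sum_(i < n) (1 - f) ^+ i) (fpsV f).
  apply: flimP => n; rewrite big_ord_recr /= -[X in eqm _ X _]addr0.
  by apply: eqmD => //; apply/eqm_sym/eqm_pow.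
apply: (@conv_unique (fun n => f * \sum_(i < n) (1 - f) ^+ i)).
  by apply: convM C; apply: conv_const.
apply: conv_eqm => n.
have -> : f * \sum_(i < n) (1 - f) ^+ i = 1 - (1 - f) ^+ n.
  by rewrite -[RHS]opprB subrX1; ring.
rewrite -[X in eqm _ _ X]subr0; apply: eqmD => //; apply: eqmN; exact: eqm_pow.
Qed.

Lemma mulfI1 (f g h : fps) : f 0%N = 1 -> f * g = f * h -> g = h.
Proof.
move=> f0 E; rewrite -[g]mul1r -[h]mul1r -(mulfVx f0).
by rewrite (mulrC f) -!mulrA E.
Qed.

(** * Dilations and sections *)

Lemma big_ord_mul (R : Type) (idx : R) (op : Monoid.law idx) (d n : nat) (F : nat -> R) :
  \big[op/idx]_(i < d * n) F i =
  \big[op/idx]_(j < n) \big[op/idx]_(r < d) F (d * j + r)%N.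
Proof.
elim: n => [|n IHn]; first by rewrite muln0 !big_ord0.
by rewrite mulnS addnC big_split_ord /= IHn big_ord_recr.
Qed.

Definition dil (d : nat) (f : fps) : fps :=
  Fps (fun n => if (d %| n)%N then f (n %/ d)%N else 0).

Definition sect (d r : nat) (f : fps) : fps := Fps (fun n => f (d * n + r)%N).

Lemma sect_dil d r f : (r < d)%N -> sect d r (dil d f) = if r == 0%N then f else 0.
Proof.
move=> lt_rd; have d_gt0 : (0 < d)%N by lia.
apply: fpsP => n /=; rewrite dvdn_addr ?dvdn_mulr //.
case: (posnP r) => [->|r_gt0]; first by rewrite addn0 dvdn0 mulKn.
by rewrite gtnNdvd // (negPf (lt0n_neq0 r_gt0)).
Qed.

(** Only multiples of [d] contribute to the convolution. This linearity over series in [X^d]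
    underlies all section computations below. *)
Lemma sect_dilM d r f g : (r < d)%N -> sect d r (dil d f * g) = f * sect d r g.
Proof.
move=> lt_rd; have d_gt0 : (0 < d)%N by lia.
apply: fpsP => n; rewrite [LHS]fcoefM [RHS]fcoefM.
pose F i := dil d f i * g (d * n + r - i)%N.
(* The range is extended to whole blocks of length [d]: no multiple of [d] lies strictly between
   [d * n + r] and [d * n.+1], so the added terms vanish. *)
transitivity (\sum_(i < d * n.+1) F i).
  rewrite -!(big_mkord xpredT F) [RHS](@big_cat_nat _ _ _ (d * n + r).+1) //=; last by lia.
  rewrite [X in _ = _ + X]big_nat_cond [X in _ = _ + X]big1 ?addr0 // => i /andP[/andP[lo hi] _].
  rewrite /F /=; case: dvdnP => [[k E]|]; last by rewrite mul0r.
  have : (n < k)%N by rewrite -(ltn_pmul2l d_gt0) mulnC in lo *; nia.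
  by move=> lt_nk; exfalso; nia.
rewrite big_ord_mul; apply: eq_bigr => j _; have := ltn_ord j => lt_j.
rewrite -(big_mkord xpredT (fun s => F (d * j + s)%N)) big_ltn // addn0 big_nat_cond big1 ?addr0.
  rewrite /F /= dvdn_mulr // mulKn //; rewrite mulnBr addnBAC //; nia.
move=> s /andP[/andP[s_gt0 lt_sd] _].
by rewrite /F /= dvdn_addr ?dvdn_mulr // gtnNdvd // mul0r.
Qed.

Lemma sectD d r f g : sect d r (f + g) = sect d r f + sect d r g.
Proof. by []. Qed.

Lemma sect_sum d r (I : Type) (s : seq I) (P : pred I) (F : I -> fps) :
  sect d r (\sum_(i <- s | P i) F i) = \sum_(i <- s | P i) sect d r (F i).
Proof. by elim/big_rec2: _ => // i y1 y2 _ <-. Qed.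

Lemma sectP d f g : (0 < d)%N ->
  (forall r, (r < d)%N -> sect d r f = sect d r g) -> f = g.
Proof.
move=> d_gt0 H; apply: fpsP => n.
have /(congr1 (fun h : fps => h (n %/ d)%N)) /= := H _ (ltn_pmod n d_gt0).
by rewrite mulnC -divn_eq.
Qed.

Lemma dilD d f g : dil d (f + g) = dil d f + dil d g.
Proof. by apply: fpsP => n /=; case: ifP => // _; rewrite ?fcoefD //= addr0. Qed.

Lemma dil0 d : dil d 0 = 0.
Proof. by apply: fpsP => n /=; case: ifP. Qed.

Lemma dilN d f : dil d (- f) = - dil d f.
Proof. by apply: fpsP => n /=; case: ifP; rewrite ?oppr0. Qed.

Lemma dilM d f g : (0 < d)%N -> dil d (f * g) = dil d f * dil d g.
Proof.
move=> d_gt0; apply: (@sectP d) => // r lt_rd.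
by rewrite sect_dilM // !sect_dil //; case: ifP; rewrite ?mulr0.
Qed.

Lemma dil1 d : (0 < d)%N -> dil d 1 = 1.
Proof.
move=> d_gt0; apply: fpsP => n /=; rewrite /sone.
case: dvdnP => [[k ->]|H]; first by rewrite mulnK // muln_eq0 (gtn_eqF d_gt0) orbF.
by case: eqP => // n0; case: H; exists 0%N; rewrite n0.
Qed.

Lemma dilX d f n : (0 < d)%N -> dil d (f ^+ n) = dil d f ^+ n.
Proof.
move=> d_gt0; elim: n => [|n IHn]; first exact: dil1.
by rewrite !exprS dilM // IHn.
Qed.

Lemma dilXn d n : (0 < d)%N -> dil d (X ^+ n) = X ^+ (d * n).
Proof.
move=> d_gt0; apply: fpsP => m /=; rewrite !fcoefXn.
case: dvdnP => [[k ->]|H]; first by rewrite mulnK // mulnC eqn_pmul2l.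
by case: eqP => // E; case: H; exists n; rewrite E mulnC.
Qed.

Lemma dil_prod d (I : Type) (s : seq I) (P : pred I) (F : I -> fps) : (0 < d)%N ->
  dil d (\prod_(i <- s | P i) F i) = \prod_(i <- s | P i) dil d (F i).
Proof.
move=> d_gt0; elim/big_rec2: _ => [|i y1 y2 _ <-]; first exact: dil1.
by rewrite dilM.
Qed.

Lemma dil_coef0 d f : dil d f 0%N = f 0%N.
Proof. by rewrite /= dvdn0 div0n. Qed.

Lemma dil_eqm d N f g : (0 < d)%N -> eqm N f g -> eqm N (dil d f) (dil d g).
Proof.
move=> d_gt0 H n lt_n /=; case: ifP => // _; apply: H.
exact: leq_ltn_trans (leq_div _ _) lt_n.
Qed.

Lemma sect_eqm d r N f g : (r < d)%N -> eqm (d * N) f g -> eqm N (sect d r f) (sect d r g).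
Proof. by move=> lt_rd H n lt_n; apply: H; nia. Qed.

Lemma conv_dil d s f : (0 < d)%N -> conv s f -> conv (fun n => dil d (s n)) (dil d f).
Proof.
move=> d_gt0 H M; have [N HN] := H M; exists N => n le_Nn.
exact/dil_eqm/HN.
Qed.

Lemma conv_sect d r s f : (r < d)%N -> conv s f -> conv (fun n => sect d r (s n)) (sect d r f).
Proof.
move=> lt_rd H M; have [N HN] := H (d * M)%N; exists N => n le_Nn.
exact/sect_eqm/HN.
Qed.

(** * Infinite products *)

(** The finite product [(-s X^i; X^k)_n]; the sign [s] is itself a series, so that both signs are
    treated at once. *)
Definition qp (s : fps) (i k n : nat) : fps := \prod_(m < n) (1 + s * X ^+ (i + k * m)).

Definition qpi (s : fps) (i k : nat) : fps := flim (qp s i k).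

Lemma qpS s i k n : qp s i k n.+1 = qp s i k n * (1 + s * X ^+ (i + k * n)).
Proof. by rewrite /qp big_ord_recr. Qed.

Lemma qp_stable s i k n : (0 < k)%N -> eqm n (qp s i k n) (qp s i k n.+1).
Proof.
move=> k_gt0; rewrite qpS -[Y in eqm _ Y _]mulr1; apply: eqmM => //.
rewrite -[Y in eqm _ Y _]addr0; apply: eqmD => //; apply: eqm_sym.
rewrite [s * _]mulrC; apply: (@eqmW _ (i + k * n)); [nia|exact: eqmX0].
Qed.

Lemma qpi_conv s i k : (0 < k)%N -> conv (qp s i k) (qpi s i k).
Proof. by move=> k_gt0; apply: flimP => n; apply: qp_stable. Qed.

Lemma qpi_eqm s i k n : (0 < k)%N -> eqm n (qp s i k n) (qpi s i k).
Proof. by move=> k_gt0; apply: flim_eqm => m; apply: qp_stable. Qed.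

Lemma qp_coef0 s i k n : (0 < i)%N -> qp s i k n 0%N = 1.
Proof.
move=> i_gt0; elim: n => [|n IHn]; first by rewrite /qp big_ord0.
by rewrite qpS fcoefM0 IHn mul1r fcoefD fcoefM0 fcoefX0 ?mulr0 ?addr0 //; lia.
Qed.

Lemma qpi_coef0 s i k : (0 < i)%N -> qpi s i k 0%N = 1.
Proof. by move=> i_gt0; rewrite /qpi /= qp_coef0. Qed.

Lemma dil_qpi d s i k : (0 < d)%N -> (0 < k)%N -> dil d s = s ->
  dil d (qpi s i k) = qpi s (d * i) (d * k).
Proof.
move=> d_gt0 k_gt0 ds; apply: (@conv_unique (qp s (d * i) (d * k))); last first.
  by apply: qpi_conv; rewrite muln_gt0 d_gt0.
apply: conv_ext (conv_dil d_gt0 (@qpi_conv s i k k_gt0)) => n.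
rewrite /qp dil_prod //; apply: eq_bigr => m _.
by rewrite dilD dil1 // dilM // ds dilXn // mulnDr mulnA.
Qed.

Lemma qp_split d s i k n :
  qp s i k (d * n) = \prod_(r < d) qp s (i + k * r) (d * k) n.
Proof.
rewrite /qp (big_ord_mul _ _ _ (fun m => 1 + s * X ^+ (i + k * m))) exchange_big /=.
by apply: eq_bigr => r _; apply: eq_bigr => m _; congr (1 + s * X ^+ _); lia.
Qed.

Lemma qpi_split d s i k : (0 < d)%N -> (0 < k)%N ->
  qpi s i k = \prod_(r < d) qpi s (i + k * r) (d * k).
Proof.
move=> d_gt0 k_gt0.
apply: (@conv_unique (fun n => qp s i k (d * n))).
  by apply: conv_sub (qpi_conv _ _ _) => // n; rewrite leq_pmull.
suff H e : conv (fun n => \prod_(r < e) qp s (i + k * r) (d * k) n)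
             (\prod_(r < e) qpi s (i + k * r) (d * k)).
  by apply: conv_ext (H d) => n; rewrite qp_split.
elim: e => [|e IHe].
  by rewrite big_ord0; apply: conv_ext (conv_const _) => n; rewrite big_ord0.
rewrite big_ord_recr; apply: (@conv_ext (fun n => (\prod_(r < e) qp s (i + k * r) (d * k) n)
  * qp s (i + k * e) (d * k) n)) => [n|]; first by rewrite big_ord_recr.
by apply: convM => //; apply: qpi_conv; rewrite muln_gt0 d_gt0.
Qed.

Lemma qpi_conj i k : (0 < k)%N ->
  qpi 1 i k * qpi (-1) i k = qpi (-1) (2 * i) (2 * k).
Proof.
move=> k_gt0; apply: (@conv_unique (qp (-1) (2 * i) (2 * k))); last first.
  by apply: qpi_conv; rewrite muln_gt0.
apply: conv_ext (convM (@qpi_conv 1 i k k_gt0) (@qpi_conv (-1) i k k_gt0)) => n.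
rewrite /qp -big_split /=; apply: eq_bigr => m _.
have -> : (2 * i + 2 * k * m = (i + k * m) * 2)%N by lia.
by rewrite exprM; ring.
Qed.

Definition etaq (d : nat) : fps := qpi (-1) d d.

Lemma etaq_coef0 d : (0 < d)%N -> etaq d 0%N = 1.
Proof. exact: qpi_coef0. Qed.

Lemma dil_etaq d e : (0 < d)%N -> (0 < e)%N -> dil d (etaq e) = etaq (d * e).
Proof. by move=> d_gt0 e_gt0; rewrite /etaq dil_qpi // dilN dil1. Qed.

(** * The even part of beta *)

Lemma fpsV_eqm N (f g : fps) : f 0%N = 1 -> g 0%N = 1 -> eqm N f g -> eqm N (fpsV f) (fpsV g).
Proof.
move=> f0 g0 H.
have -> : fpsV f = fpsV f * g * fpsV g by rewrite -mulrA mulfVx // mulr1.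
rewrite -[Y in eqm _ _ Y]mul1r -[Y in eqm _ _ (Y * _)](mulfVx f0) [f * _]mulrC.
by do 2![apply: eqmM => //]; apply: eqm_sym.
Qed.

Ltac xpow := rewrite -?exprM -?exprD; congr (X ^+ _); nia.

(** * Finite q-factorials and the Bailey-pair expansion *)

Definition qf (n : nat) : fps := qp (-1) 1 1 n.
Definition qe (n : nat) : fps := fpsV (qf n).
Definition pp (n : nat) : fps := qp 1 1 1 n.

Lemma qf_coef0 n : qf n 0%N = 1. Proof. exact: qp_coef0. Qed.

Lemma mul_qe n : qf n * qe n = 1.
Proof. exact/mulfVx/qf_coef0. Qed.

Lemma qe0 : qe 0 = 1.
Proof. by have := mul_qe 0; rewrite {1}/qf /qp big_ord0 mul1r. Qed.

Lemma qeS n : qe n = (1 - X ^+ n.+1) * qe n.+1.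
Proof.
apply: (mulfI1 (qf_coef0 n)); rewrite mul_qe; have := mul_qe n.+1.
by rewrite {1}/qf qpS -/(qf n) mul1n add1n => H; rewrite -[LHS]H; ring.
Qed.

Lemma ppS n : pp n.+1 = pp n * (1 + X ^+ n.+1).
Proof. by rewrite /pp qpS mul1r mul1n add1n. Qed.

Definition rr (k : nat) : fps := (1 + X ^+ (2 * k + 1)) * fpsV (1 - X ^+ (2 * k + 1)).

Lemma coef0_1subX n : (0 < n)%N -> (1 - X ^+ n) 0%N = 1.
Proof. by move=> n_gt0; rewrite fcoefD fcoefN fcoefX0 // oppr0 addr0. Qed.

Lemma mul_rr k : rr k * (1 - X ^+ (2 * k + 1)) = 1 + X ^+ (2 * k + 1).
Proof.
rewrite /rr -mulrA [fpsV _ * _]mulrC mulfVx ?mulr1 //.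
by apply: coef0_1subX; rewrite addn1.
Qed.

(** With [y = X^(2k+1)], [(1 + y)/(1 - y) = (1 + y^2 + 2y)/(1 - y^2)]. The even part drops [2y], and
    replacing [X^2] by [X] turns [y^2] back into [y]. *)
Lemma sect_rr k : sect 2 0 (rr k) = rr k.
Proof.
set y := X ^+ (2 * k + 1); have y0 : (1 - y) 0%N = 1 by apply: coef0_1subX; lia.
have dy : dil 2 y = y ^+ 2 by rewrite /y dilXn // -exprM mulnC.
have E : rr k = dil 2 (fpsV (1 - y)) * (1 + y ^+ 2 + (y + y)).
  apply: (mulfI1 y0); rewrite [LHS]mulrC mul_rr -/y.
  have : dil 2 (1 - y) * dil 2 (fpsV (1 - y)) = 1 by rewrite -dilM // mulfVx // dil1.
  rewrite dilD dil1 // dilN dy => Hd.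
  transitivity ((1 + y) * ((1 - y ^+ 2) * dil 2 (fpsV (1 - y)))); first by rewrite Hd mulr1.
  by ring.
rewrite {1}E sect_dilM // !sectD.
have -> : sect 2 0 y = 0.
  by apply: fpsP => n /=; rewrite /y fcoefXn; case: eqP => //; lia.
have -> : sect 2 0 1 = 1 by rewrite -{1}(@dil1 2) // sect_dil.
by rewrite -dy sect_dil // !addr0 mulrC.
Qed.

(* [abp n = 1 / (q;q^2)_{n+1}^2], see [abp_odd]. *)
Definition abp (n : nat) : fps :=
  \sum_(k < n.+1) (-1) ^+ k * X ^+ (k * k.+1) * rr k * dil 2 (qe (n - k) * qe (n + k + 1)).

Definition qe2 (m : nat) : fps := dil 2 (qe m).

Lemma qe2S m : qe2 m = (1 - X ^+ m.+1 ^+ 2) * qe2 m.+1.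
Proof. by rewrite /qe2 qeS dilM // dilD dil1 // dilN dilXn // mulnC exprM. Qed.

(** A closed form for the partial sums met in [abp_step]. At [K = N] it cancels the one remaining
    term [k = N], so the full sum is zero once [1 - X^(2N)] can be cancelled. *)
Lemma abp_telescope N K : (K <= N)%N ->
  (1 - X ^+ (2 * N)) *
  (\sum_(k < K) (-1) ^+ k * X ^+ (k * k.-1) * (1 - X ^+ (2 * k + 1) ^+ 2) * qe2 (N - k) * qe2 (N + k + 1))
  = - (-1) ^+ K * X ^+ (K * K.-1) * (1 - X ^+ (2 * K)) * qe2 (N - K) * qe2 (N + K).
Proof.
elim: K => [|K IHK] leKN; first by rewrite big_ord0 muln0 subrr; ring.
rewrite big_ord_recr mulrDr IHK 1?ltnW //=.
have [j ->] : exists j, N = (K + j.+1)%N by exists (N - K.+1)%N; lia.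
have -> : (K + j.+1 - K = j.+1)%N by lia.
have -> : (K + j.+1 - K.+1 = j)%N by lia.
rewrite (qe2S j) (qe2S (K + j.+1 + K)).
have -> : (K + j.+1 + K.+1 = (K + j.+1 + K).+1)%N by lia.
have -> : (K + j.+1 + K + 1 = (K + j.+1 + K).+1)%N by lia.
have -> : X ^+ (K.+1 * K) = X ^+ (K * K.-1) * X ^+ K ^+ 2 by xpow.
have -> : X ^+ (2 * (K + j.+1)) = X ^+ K ^+ 2 * X ^+ j ^+ 2 * X ^+ 2 by xpow.
have -> : X ^+ (K + j.+1 + K).+1 = X ^+ K ^+ 2 * X ^+ j * X ^+ 2 by xpow.
have -> : X ^+ (2 * K + 1) = X ^+ K ^+ 2 * X ^+ 1 by xpow.
have -> : X ^+ (2 * K) = X ^+ K ^+ 2 by xpow.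
have -> : X ^+ (2 * K.+1) = X ^+ K ^+ 2 * X ^+ 2 by xpow.
have -> : X ^+ j.+1 = X ^+ j * X ^+ 1 by xpow.
rewrite [(-1) ^+ K.+1]exprS; ring.
Qed.

(** Over common denominators, the difference of the two sides is [X^(2n+2)] times the sum of
    [abp_telescope] with [N = n.+1], which vanishes. *)
Lemma abp_step n : (1 - X ^+ (2 * n + 3)) ^+ 2 * abp n.+1 = abp n.
Proof.
have E : abp n = \sum_(k < n.+2) (-1) ^+ k * X ^+ (k * k.+1) * rr k *
   ((1 - X ^+ (n.+1 - k) ^+ 2) * (1 - X ^+ (n.+1 + k + 1) ^+ 2) * (qe2 (n.+1 - k) * qe2 (n.+1 + k + 1))).
  (* The added term [k = n.+1] is zero because it contains the factor [1 - X^0]. *)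
  rewrite [RHS]big_ord_recr /= subnn expr0 expr1n subrr !(mul0r, mulr0) addr0.
  apply: eq_bigr => k _; congr (_ * _); rewrite dilM // -/(qe2 _) -/(qe2 _).
  have [j jE] : exists j, n = (k + j)%N by exists (n - k)%N; have := ltn_ord k; lia.
  have -> : (n - k = j)%N by lia.
  have -> : (n.+1 - k = j.+1)%N by lia.
  rewrite (qe2S j) (qe2S (n + k + 1)) !addn1 addSn; ring.
apply/eqP; rewrite -subr_eq0; apply/eqP.
have u0 : (1 - X ^+ (2 * n.+1)) 0%N = 1 by apply: coef0_1subX.
apply: (mulfI1 u0); rewrite mulr0 E /abp mulr_sumr -sumrB.
transitivity ((1 - X ^+ (2 * n.+1)) * (X ^+ (2 * n.+1) * \sum_(k < n.+2)
   ((-1) ^+ k * X ^+ (k * k.-1) * (1 - X ^+ (2 * k + 1) ^+ 2) * qe2 (n.+1 - k) * qe2 (n.+1 + k + 1)))).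
  congr (_ * _); rewrite mulr_sumr; apply: eq_bigr => -[k lt_k] _ /=.
  rewrite dilM // -/(qe2 _) -/(qe2 _).
  have -> : 1 - X ^+ (2 * k + 1) ^+ 2 = rr k * (1 - X ^+ (2 * k + 1)) ^+ 2.
    by rewrite expr2 mulrA mul_rr; ring.
  have [j jE] : exists j, n.+1 = (k + j)%N by exists (n.+1 - k)%N; lia.
  have -> : (2 * n + 3 = (k + j) * 2 + 1)%N by lia.
  have -> : (n.+1 - k = j)%N by lia.
  rewrite jE.
  have -> : X ^+ (k * k.+1) = X ^+ (k * k.-1) * X ^+ k ^+ 2 by xpow.
  have -> : X ^+ ((k + j) * 2 + 1) = X ^+ k ^+ 2 * X ^+ j ^+ 2 * X ^+ 1 by xpow.
  have -> : X ^+ (k + j + k + 1) = X ^+ k ^+ 2 * X ^+ j * X ^+ 1 by xpow.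
  have -> : X ^+ (2 * k + 1) = X ^+ k ^+ 2 * X ^+ 1 by xpow.
  have -> : X ^+ (2 * (k + j)) = X ^+ k ^+ 2 * X ^+ j ^+ 2 by xpow.
  ring.
rewrite mulrCA big_ord_recr /= mulrDr abp_telescope // subnn.
rewrite (qe2S (n.+1 + n.+1)).
have -> : (n.+1 + n.+1 + 1 = (n.+1 + n.+1).+1)%N by lia.
have -> : (2 * n.+1 + 1 = (n.+1 + n.+1).+1)%N by lia.
ring.
Qed.

Lemma abp_odd n : abp n * qp (-1) 1 2 n.+1 ^+ 2 = 1.
Proof.
elim: n => [|n IHn].
  rewrite /abp big_ord_recl big_ord0 /= !mul0n sub0n qe0 mul1r !mul1r addr0.
  rewrite /qp big_ord_recl big_ord0 muln0 addn0 mulr1.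
  have H1 : 1 = (1 - X ^+ 2) * dil 2 (qe 1) by have := qe2S 0; rewrite /qe2 qe0 dil1.
  have H2 : rr 0 * (1 - X) = 1 + X := mul_rr 0.
  transitivity (rr 0 * (1 - X) * (1 - X) * dil 2 (qe 1)); first by ring.
  by rewrite H2 [RHS]H1; ring.
rewrite qpS -{}[RHS]IHn -(abp_step n) exprMn.
have -> : (1 + 2 * n.+1 = 2 * n + 3)%N by lia.
ring.
Qed.

(** * Creative telescoping of the inner sums *)

Definition ut (k m : nat) : fps :=
  X ^+ ('C(m, 2) + m * k.+1) * pp (k + m) * qe m * qe (2 * k + 1 + m).

(* The certificate of the creative telescoping in [ut_telescope]. *)
Definition ut_cert (k m : nat) : fps :=
  X ^+ ('C(m, 2) + m * k.+1) * pp (k + m) * qe m * (1 - X ^+ m) *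
  (1 + X ^+ (m + k + 1) * (1 - X ^+ (k + 1))) * qe (2 * k + 2 + m).

(** Summed over [m], the right-hand side collapses, and [ut_cert k 0 = 0]; hence the sum of [ut k m]
    over all [m] does not depend on [k]. After division by common factors this is a polynomial
    identity in [X^k], [X^m] and [X]. *)
Lemma ut_telescope k m : ut k m - ut k.+1 m = ut_cert k m - ut_cert k m.+1.
Proof.
rewrite /ut /ut_cert.
have -> : (k.+1 + m = (k + m).+1)%N by lia.
have -> : (k + m.+1 = (k + m).+1)%N by lia.
have -> : (2 * k + 1 + m = 2 * k + m + 1)%N by lia.
have -> : (2 * k + 2 + m = (2 * k + m + 1).+1)%N by lia.
have -> : (2 * k.+1 + 1 + m = (2 * k + m + 1).+2)%N by lia.
have -> : (2 * k + 2 + m.+1 = (2 * k + m + 1).+2)%N by lia.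
rewrite (qeS (2 * k + m + 1)) (qeS (2 * k + m + 1).+1) (qeS m) ppS.
set e1 := qe _; set e2 := qe _; set p := pp _.
have -> : X ^+ ('C(m, 2) + m * k.+2) = X ^+ ('C(m, 2) + m * k.+1) * X ^+ m by xpow.
have -> : X ^+ ('C(m.+1, 2) + m.+1 * k.+1) = X ^+ ('C(m, 2) + m * k.+1) * X ^+ m * X ^+ k * X ^+ 1.
  by rewrite binS bin1; xpow.
have -> : X ^+ (2 * k + m + 1).+1 = X ^+ k ^+ 2 * X ^+ m * X ^+ 2 by xpow.
have -> : X ^+ (2 * k + m + 1).+2 = X ^+ k ^+ 2 * X ^+ m * X ^+ 3 by xpow.
have -> : X ^+ (m + k + 1) = X ^+ k * X ^+ m * X ^+ 1 by xpow.
have -> : X ^+ (m.+1 + k + 1) = X ^+ k * X ^+ m * X ^+ 2 by xpow.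
have -> : X ^+ (k + m).+1 = X ^+ k * X ^+ m * X ^+ 1 by xpow.
have -> : X ^+ (k + 1) = X ^+ k * X ^+ 1 by xpow.
have -> : X ^+ m.+1 = X ^+ m * X ^+ 1 by xpow.
ring.
Qed.

Definition uinf : fps := qpi 1 1 1 * fpsV (etaq 1).

Lemma qe_eqm n : eqm n (qe n) (fpsV (etaq 1)).
Proof.
by apply: fpsV_eqm; rewrite ?qf_coef0 ?etaq_coef0 //; apply: qpi_eqm.
Qed.

(** Passing from [k] to [k.+1] costs [ut_cert k L], a multiple of [X^L]. So [k] may be replaced by
    [k + L], where modulo [X^L] only the term [m = 0] survives and its products have reached their
    limits. *)
Lemma ut_sum_eqm k L : eqm L (\sum_(m < L) ut k m) uinf.
Proof.
have H1 j : eqm L (\sum_(m < L) ut j m) (\sum_(m < L) ut j.+1 m).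
  have E : \sum_(m < L) ut j m - \sum_(m < L) ut j.+1 m = - ut_cert j L.
    rewrite -sumrB (eq_bigr (fun m : 'I_L => - (ut_cert j m.+1 - ut_cert j m))) => [|m _].
      rewrite sumrN -(big_mkord xpredT (fun m => ut_cert j m.+1 - ut_cert j m)) telescope_sumr //.
      by rewrite {2}/ut_cert expr0 subrr !(mulr0, mul0r) subr0.
    by rewrite ut_telescope opprB.
  move/eqP: E; rewrite subr_eq => /eqP ->.
  rewrite -[Y in eqm _ _ Y]add0r; apply: eqmD => //.
  rewrite -[Y in eqm _ _ Y]oppr0; apply: eqmN; rewrite /ut_cert -!mulrA.
  by apply: eqmXW; nia.
have H2 j : eqm L (\sum_(m < L) ut k m) (\sum_(m < L) ut (k + j) m).
  elim: j => [|j IHj]; first by rewrite addn0.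
  by apply: eqm_trans IHj _; rewrite addnS.
apply: eqm_trans (H2 L) _.
case: L {H1 H2} => [|L] //.
rewrite big_ord_recl -[Y in eqm _ _ Y]addr0; apply: eqmD.
  rewrite /ut bin0n mul0n addn0 expr0 mul1r qe0 mulr1 addn0.
  apply: eqmM; first by apply: (@eqmW _ (k + L.+1)); [lia|apply: qpi_eqm].
  by refine (eqmW _ (@qe_eqm _)); lia.
move=> n lt_n; rewrite fcoef_sum big1 // => i _; move: n lt_n.
by rewrite /ut -!mulrA; apply: eqmXW; rewrite /= /bump /=; nia.
Qed.

(** * From the defining sum to a quotient of infinite products *)

Definition beta_even : fps := Fps (fun n => frak_b (2 * n)).

Lemma sprodE k (F : nat -> series) :
  Fps (sprod k F) = \prod_(j < k) Fps (F j).
Proof.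
rewrite -(big_mkord xpredT (fun j => Fps (F j))) unlock /reducebig /index_iota subn0.
rewrite /sprod; elim: (iota 0 k) => //= j s <-.
by apply: fpsP.
Qed.

Lemma poch_mq2E k : Fps (poch_mq2 k) = dil 2 (pp k).
Proof.
rewrite /poch_mq2 sprodE /pp /qp dil_prod //; apply: eq_bigr => j _.
rewrite dilD dil1 // mul1r dilXn //; apply: fpsP => n.
rewrite fcoefD fcoefXn fcoef1 /= /sonePlus; congr (_ + (_ == _)%:R); lia.
Qed.

Lemma geomInvE m : (0 < m)%N -> Fps (sgeomInv m) * (1 - X ^+ m) = 1.
Proof.
move=> m_gt0; apply: fpsP => n; rewrite mulrBr mulr1 fcoefD fcoefN mulrC fcoefXnM fcoef1 /=.
rewrite /sgeomInv; case: ltnP => lt_nm.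
  rewrite subr0; case: (posnP n) => [->|n_gt0]; first by rewrite dvdn0.
  by rewrite gtnNdvd // (gtn_eqF n_gt0).
have -> : (m %| n - m)%N = (m %| n)%N by rewrite -{2}(subnK lt_nm) dvdn_addl.
by rewrite subrr (_ : (n == 0)%N = false) //; lia.
Qed.

Lemma inv_poch_qE k : Fps (inv_poch_q k) * qp (-1) 1 2 k = 1.
Proof.
rewrite /inv_poch_q sprodE /qp -big_split big1 //= => j _.
by rewrite mulN1r addnC geomInvE // addn1.
Qed.

(** Both [abp n] and the square of [inv_poch_q n.+1] are inverse to [(X; X^2)_{n+1}^2], hence they
    are equal. *)
Lemma beta_termE n : Fps (beta_term n) = X ^+ (n * n.+1) * (dil 2 (pp n) * abp n).
Proof.
set h := Fps (inv_poch_q n.+1).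
have -> : abp n = h * h.
  have E := inv_poch_qE n.+1; have E' := abp_odd n; rewrite -/h in E.
  rewrite -[h]mulr1 -[LHS]mulr1 -[in LHS](expr1n _ 2) -[in LHS]E.
  transitivity (h * h * (abp n * qp (-1) 1 2 n.+1 ^+ 2)); first by ring.
  by rewrite E'; ring.
rewrite -poch_mq2E; have <- : Fps (sxpow (n * n.+1)) = X ^+ (n * n.+1).
  by apply: fpsP => i; rewrite fcoefXn.
by [].
Qed.

Definition btot (K : nat) : fps := \sum_(k < K) (-1) ^+ k * X ^+ (k * k.+1) * rr k.

Lemma triangle_sum (R : nmodType) K (F : nat -> nat -> R) :
  \sum_(n < K) \sum_(k < n.+1) F k (n - k)%N = \sum_(k < K) \sum_(m < K - k) F k m.
Proof.
elim: K => [|K IHK]; first by rewrite !big_ord0.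
rewrite big_ord_recr /= IHK [RHS]big_ord_recr /= subSnn big_ord1.
rewrite big_ord_recr /= subnn addrA; congr (_ + _).
rewrite -big_split; apply: eq_bigr => k _ /=.
by rewrite subSn ?big_ord_recr //=; have := ltn_ord k; lia.
Qed.

Lemma tri2 n : (2 * 'C(n.+1, 2) = n * n.+1)%N.
Proof. by elim: n => // n IHn; rewrite binS bin1 mulnDr IHn; nia. Qed.

(** Every factor except [rr k] is a series in [X^2], and [rr k] is reproduced by the even section.
    The exponents recombine through [n = k + m]. *)
Lemma sect_beta_term n :
  sect 2 0 (Fps (beta_term n)) =
  \sum_(k < n.+1) (-1) ^+ k * X ^+ (k * k.+1) * rr k * ut k (n - k).
Proof.
have tri k : (k * k.+1 = 2 * 'C(k.+1, 2))%N by rewrite tri2.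
rewrite beta_termE tri -dilXn // sect_dilM // sect_dilM // /abp sect_sum !mulr_sumr.
apply: eq_bigr => -[k lt_k] _ /=; rewrite tri -dilXn //.
set Y := qe _ * qe _.
have -> : (-1) ^+ k * dil 2 (X ^+ 'C(k.+1, 2)) * rr k * dil 2 Y =
    dil 2 ((-1) ^+ k * X ^+ 'C(k.+1, 2) * Y) * rr k.
  by rewrite !dilM // (dilX (-1)) // dilN dil1 //; ring.
rewrite sect_dilM // sect_rr {}/Y.
rewrite /ut.
have [m ->] : exists m, n = (k + m)%N by exists (n - k)%N; lia.
have -> : (k + m - k = m)%N by lia.
have -> : (k + m + k + 1 = 2 * k + 1 + m)%N by lia.
have -> : X ^+ 'C((k + m).+1, 2) = X ^+ 'C(k.+1, 2) * X ^+ ('C(m, 2) + m * k.+1).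
  rewrite -exprD; congr (X ^+ _); have := tri k; have := tri (k + m)%N; have := tri m.
  by rewrite (binS m) bin1; nia.
have -> : dil 2 (X ^+ 'C(k.+1, 2)) = X ^+ 'C(k.+1, 2) ^+ 2 by rewrite dilXn // mulnC exprM.
ring.
Qed.

Lemma beta_term_coef0 k n : (n < k * k.+1)%N -> beta_term k n = 0.
Proof.
by move=> lt_n; rewrite -[LHS]/(Fps (beta_term k) n) beta_termE fcoefXnM lt_n.
Qed.

Lemma beta_even_eqm K : eqm K beta_even (uinf * btot K).
Proof.
apply: (@eqm_trans _ (\sum_(n < K) sect 2 0 (Fps (beta_term n)))).
  move=> m lt_m; rewrite fcoef_sum /= addn0 /frak_b.
  have E M : (m < M)%N -> \sum_(k < M) beta_term k (2 * m) = \sum_(k < m.+1) beta_term k (2 * m).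
    move=> lt_mM; rewrite -!(big_mkord xpredT (fun k => beta_term k (2 * m))).
    rewrite (@big_cat_nat _ _ _ m.+1) //= [X in _ + X]big_nat_cond [X in _ + X]big1 ?addr0 //.
    move=> k /andP[/andP[lo _] _]; apply: beta_term_coef0; nia.
  by rewrite !E //; lia.
under eq_bigr do rewrite sect_beta_term.
rewrite (triangle_sum K (fun k m => (-1) ^+ k * X ^+ (k * k.+1) * rr k * ut k m)).
rewrite /btot mulr_sumr; apply: eqm_sum => k _; rewrite -mulr_sumr.
have -> (y : fps) : (-1) ^+ k * X ^+ (k * k.+1) * rr k * y =
   X ^+ (k * k.+1) * ((-1) ^+ k * rr k * y) by ring.
have -> : uinf * ((-1) ^+ k * X ^+ (k * k.+1) * rr k) =
   X ^+ (k * k.+1) * ((-1) ^+ k * rr k * uinf) by ring.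
(* The inner sum is known only modulo [X^(K - k)]; the factor [X^(k(k+1))] makes up for the missing
   [k]. *)
apply: (@eqmW _ (k * k.+1 + (K - k))); first by have := ltn_ord k; nia.
by apply: eqmXM; apply: eqmM => //; apply: ut_sum_eqm.
Qed.

(** The limit of [abp_odd]: for fixed [k], both [qe (n - k)] and [qe (n + k + 1)] tend to
    [1/(X; X)_oo]. *)
Lemma btot_eqm n :
  eqm n (btot n.+1 * dil 2 (fpsV (etaq 1)) ^+ 2 * qpi (-1) 1 2 ^+ 2) 1.
Proof.
rewrite -[Y in eqm _ _ Y](abp_odd n); apply: eqmM; last first.
  by rewrite !expr2; apply: eqmM; apply: eqm_sym; apply: (@eqmW n n.+1) => //; apply: qpi_eqm.
rewrite /btot /abp mulr_suml; apply: eqm_sum => k _.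
have E (y : fps) : (-1) ^+ k * X ^+ (k * k.+1) * rr k * y =
   X ^+ (k * k.+1) * ((-1) ^+ k * rr k * y) by ring.
rewrite !E.
apply: (@eqmW _ (k * k.+1 + (n - k))); first by have := ltn_ord k; nia.
apply: eqmXM; apply: eqmM => //; rewrite -dilX //; apply: dil_eqm => //.
by apply: eqmM; apply: eqm_sym; refine (eqmW _ (@qe_eqm _)); lia.
Qed.

Lemma qpi_odd : qpi (-1) 1 2 * etaq 2 = etaq 1.
Proof. by rewrite /etaq (@qpi_split 2 (-1) 1 1) // !big_ord_recl big_ord0 mulr1. Qed.

Lemma qpi_dist1 : qpi 1 1 1 * etaq 1 = etaq 2.
Proof. by rewrite /etaq qpi_conj. Qed.

(** The even part is [uinf] times the limit of [btot]. In Euler products these are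
    [etaq 2 / etaq 1^2] and [etaq 2^4 / etaq 1^2]. *)
Theorem beta_evenE : beta_even * etaq 1 ^+ 4 = etaq 2 ^+ 5.
Proof.
have E : beta_even * dil 2 (fpsV (etaq 1)) ^+ 2 * qpi (-1) 1 2 ^+ 2 = uinf.
  apply: eqm_unique => n; rewrite -[Y in eqm _ _ Y]mulr1.
  apply: (@eqm_trans _ (uinf * (btot n.+1 * dil 2 (fpsV (etaq 1)) ^+ 2 * qpi (-1) 1 2 ^+ 2))).
    rewrite -mulrA -[btot _ * _ * _]mulrA [Y in eqm _ _ Y]mulrA; apply: eqmM => //.
    by refine (eqmW _ (@beta_even_eqm n.+1)).
  by apply: eqmM => //; apply: btot_eqm.
have E1 : dil 2 (fpsV (etaq 1)) * etaq 2 = 1.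
  by rewrite -[etaq 2](@dil_etaq 2 1) // -dilM // mulrC mulfVx ?dil1 // etaq_coef0.
have E3 : etaq 1 * fpsV (etaq 1) = 1 by rewrite mulfVx // etaq_coef0.
transitivity (beta_even * dil 2 (fpsV (etaq 1)) ^+ 2 * qpi (-1) 1 2 ^+ 2 * etaq 2 ^+ 4 * etaq 1 ^+ 2).
  transitivity (beta_even * (dil 2 (fpsV (etaq 1)) * etaq 2) ^+ 2 *
    (qpi (-1) 1 2 * etaq 2) ^+ 2 * etaq 1 ^+ 2); last by ring.
  by rewrite E1 qpi_odd; ring.
rewrite E /uinf.
transitivity (qpi 1 1 1 * etaq 1 * (etaq 1 * fpsV (etaq 1)) * etaq 2 ^+ 4); first by ring.
by rewrite E3 qpi_dist1; ring.
Qed.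

(** * The Jacobi triple product *)

(** The Gaussian binomial coefficient. The case split is essential: for [n < l] truncated
    subtraction would give [qe (n - l) = 1]. *)
Definition gbin (n l : nat) : fps := if (l <= n)%N then qf n * qe l * qe (n - l) else 0.

Lemma qfS n : qf n.+1 = qf n * (1 - X ^+ n.+1).
Proof. by rewrite /qf qpS mulN1r mul1n add1n. Qed.

Lemma gbin_small n l : (n < l)%N -> gbin n l = 0.
Proof. by rewrite /gbin; case: leqP. Qed.

Lemma gbinn0 n : gbin n 0 = 1.
Proof. by rewrite /gbin leq0n subn0 qe0 mulr1 mul_qe. Qed.

Lemma gbinnn n : gbin n n = 1.
Proof. by rewrite /gbin leqnn subnn qe0 mulr1 mul_qe. Qed.

(** One of the two q-Pascal rules; [gbinS_r] is the other. Each of them absorbs one family of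
    factors in the finite triple product. *)
Lemma gbinS_l n l : gbin n.+1 l.+1 = gbin n l + X ^+ l.+1 * gbin n l.+1.
Proof.
case: (ltngtP l n) => [lt_ln|lt_nl|->]; last 2 first.
- by rewrite !gbin_small ?mulr0 ?addr0 //; lia.
- by rewrite !gbinnn gbin_small // mulr0 addr0.
have [m ->] : exists m, n = (l + m.+1)%N by exists (n - l.+1)%N; lia.
rewrite /gbin !ifT; try lia.
have -> : ((l + m.+1).+1 - l.+1 = m.+1)%N by lia.
have -> : (l + m.+1 - l.+1 = m)%N by lia.
have -> : (l + m.+1 - l = m.+1)%N by lia.
rewrite qfS (qeS l) (qeS m).
have -> : X ^+ (l + m.+1).+1 = X ^+ l.+1 * X ^+ m.+1 by xpow.
ring.
Qed.

Lemma gbinS_r n l : (l <= n)%N -> gbin n.+1 l.+1 = X ^+ (n - l) * gbin n l + gbin n l.+1.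
Proof.
case: (ltngtP l n) => [lt_ln _|//|-> _]; last first.
  by rewrite !gbinnn gbin_small // subnn expr0 mul1r addr0.
have [m ->] : exists m, n = (l + m.+1)%N by exists (n - l.+1)%N; lia.
rewrite /gbin !ifT; try lia.
have -> : ((l + m.+1).+1 - l.+1 = m.+1)%N by lia.
have -> : (l + m.+1 - l.+1 = m)%N by lia.
have -> : (l + m.+1 - l = m.+1)%N by lia.
rewrite qfS (qeS l) (qeS m).
have -> : X ^+ (l + m.+1).+1 = X ^+ l.+1 * X ^+ m.+1 by xpow.
ring.
Qed.

(* For [z : int] this is [i * z(z+1)/2 + j * z(z-1)/2], see [texpE]. *)
Definition texp (i j : nat) (z : int) : nat :=
  match z with
  | Posz n => i * 'C(n.+1, 2) + j * 'C(n, 2)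
  | Negz n => i * 'C(n.+1, 2) + j * 'C(n.+2, 2)
  end.

Lemma texpE i j z : 2 * (texp i j z)%:Z = i%:Z * (z * (z + 1)) + j%:Z * (z * (z - 1)).
Proof.
case: z => n; rewrite /texp.
  have H1 := tri2 n; have H2 : (2 * 'C(n, 2) + 2 * n = n * n.+1)%N by rewrite -H1 binS bin1; lia.
  nia.
have H1 := tri2 n; have H2 := tri2 n.+1; rewrite NegzE; nia.
Qed.

Lemma texpD1 i j z : (texp i j (z + 1))%:Z = (texp i j z)%:Z + i%:Z + (i + j)%:Z * z.
Proof. have := texpE i j z; have := texpE i j (z + 1); lia. Qed.

Lemma texp_ge i j z : (0 < i)%N -> (0 < j)%N -> (`|z| <= texp i j z)%N.
Proof. move=> ip jp; have := texpE i j z; nia. Qed.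

(** The summand of a two-sided theta series. When [s * s = 1], the exponent [absz z] gives the power
    [s^z]. *)
Definition tterm (s : fps) (i j : nat) (z : int) : fps := s ^+ absz z * X ^+ texp i j z.

Lemma sgnD1 (s : fps) (z : int) : s * s = 1 -> s ^+ absz (z + 1) = s * s ^+ absz z.
Proof.
move=> ss; case: z => n; first by rewrite -exprS; congr (s ^+ _); lia.
have -> : absz (Negz n) = (absz (Negz n + 1)).+1 by lia.
by rewrite exprS mulrA ss mul1r.
Qed.

Section FiniteJTP.

Variables (s : fps) (i j : nat).
Hypotheses (ss : s * s = 1) (kp : (0 < i + j)%N).

Let G n l := dil (i + j) (gbin n l).

Let T M N := \sum_(l < (M + N).+1) tterm s i j (l%:Z - N%:Z) * G (M + N) l.

Let G0 n : G n 0 = 1. Proof. by rewrite /G gbinn0 dil1. Qed.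
Let Gn n : G n n.+1 = 0. Proof. by rewrite /G gbin_small // dil0. Qed.

Let shift_sum n (F : nat -> fps) :
  \sum_(l < n.+1) F l * G n l = F 0%N + \sum_(l < n.+1) F l.+1 * G n l.+1.
Proof.
by rewrite big_ord_recl G0 mulr1 [in RHS]big_ord_recr /= Gn mulr0 addr0.
Qed.

Let stepM M N : T M N * (1 + s * X ^+ (i + (i + j) * M)) = T M.+1 N.
Proof.
rewrite /T addSn [RHS]big_ord_recl G0 mulr1 /=.
set n := (M + N)%N.
have E (l : 'I_n.+1) : tterm s i j ((bump 0 l)%:Z - N%:Z) * G n.+1 (bump 0 l) =
   tterm s i j (l%:Z - N%:Z) * G n l * (s * X ^+ (i + (i + j) * M)) +
   tterm s i j (l.+1%:Z - N%:Z) * G n l.+1.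
  case: l => l lt_l /=; rewrite /bump /= add1n {1}/G gbinS_r // dilD dilM // dilXn // -/(G _ _) -/(G _ _).
  rewrite mulrDr; congr (_ + _).
  have -> : l.+1%:Z - N%:Z = (l%:Z - N%:Z) + 1 by lia.
  have Te := texpD1 i j (l%:Z - N%:Z).
  rewrite /tterm sgnD1 //.
  (* With [z = l - N], [texp] grows by [i + (i + j) z] from [z] to [z + 1], and the q-Pascal weight
     [(i + j)(M + N - l)] completes this to [i + (i + j) M]. *)
  have Ee : X ^+ texp i j (l%:Z - N%:Z + 1) * X ^+ ((i + j) * (n - l)) =
     X ^+ texp i j (l%:Z - N%:Z) * X ^+ (i + (i + j) * M).
    rewrite -!exprD; congr (X ^+ _); have [m Em] : exists m, n = (l + m)%N by exists (n - l)%N; lia.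
    have -> : (n - l = m)%N by lia.
    have : ((i + j) * (M + N) = (i + j) * (l + m))%N by rewrite -Em.
    move: Te; move: (i + j)%N (texp _ _ _) (texp _ _ _) => k a b Ha Hk; nia.
  transitivity (s * s ^+ absz (l%:Z - N%:Z) * (X ^+ texp i j (l%:Z - N%:Z + 1) * X ^+ ((i + j) * (n - l))) * G n l).
    by ring.
  by rewrite Ee; ring.
rewrite (eq_bigr _ (fun l _ => E l)) big_split /= addrCA -mulr_suml.
rewrite -(shift_sum n (fun l => tterm s i j (l%:Z - N%:Z))); ring.
Qed.

Let stepN M N : T M N * (1 + s * X ^+ (j + (i + j) * N)) = T M N.+1.
Proof.
rewrite /T addnS [RHS]big_ord_recl G0 mulr1 /=.
set n := (M + N)%N.
have E (l : 'I_n.+1) : tterm s i j ((bump 0 l)%:Z - N.+1%:Z) * G n.+1 (bump 0 l) =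
   tterm s i j (l%:Z - N%:Z) * G n l +
   tterm s i j (l%:Z - N%:Z) * X ^+ ((i + j) * l.+1) * G n l.+1.
  case: l => l lt_l /=; rewrite /bump /= add1n {1}/G gbinS_l // dilD dilM // dilXn // -/(G _ _) -/(G _ _).
  have -> : l.+1%:Z - N.+1%:Z = (l%:Z - N%:Z) by lia.
  ring.
rewrite (eq_bigr _ (fun l _ => E l)) big_split /= addrCA mulrDr mulr1; congr (_ + _).
pose F l := tterm s i j (l%:Z - N.+1%:Z) * X ^+ ((i + j) * l).
have -> : \sum_(l < n.+1) tterm s i j (l%:Z - N%:Z) * X ^+ ((i + j) * l.+1) * G n l.+1 =
   \sum_(l < n.+1) F l.+1 * G n l.+1.
  by apply: eq_bigr => l _; rewrite /F; congr (tterm s i j _ * _ * _); lia.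
have -> : tterm s i j (0%:Z - N.+1%:Z) = F 0%N by rewrite /F muln0 expr0 mulr1.
rewrite -shift_sum mulr_suml; apply: eq_bigr => -[l lt_l] _ /=.
rewrite /F; set z := l%:Z - N.+1%:Z.
have -> : l%:Z - N%:Z = z + 1 by rewrite /z; lia.
have Te := texpD1 i j z; rewrite /tterm sgnD1 //.
have Ee : X ^+ texp i j z * X ^+ ((i + j) * l) = X ^+ texp i j (z + 1) * X ^+ (j + (i + j) * N).
  by rewrite -!exprD; congr (X ^+ _); move: Te; rewrite /z; move: (texp _ _ _) (texp _ _ _); nia.
transitivity ((s * s) * (s ^+ absz z * (X ^+ texp i j (z + 1) * X ^+ (j + (i + j) * N)) * G n l)).
  by ring.
by rewrite -Ee ss; ring.
Qed.

(** The finite Jacobi triple product, by induction on [N] and then on [M]; each new factor is one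
    q-Pascal step in base [X^(i+j)]. *)
Lemma finite_jtp M N :
  qp s i (i + j) M * qp s j (i + j) N =
  \sum_(l < (M + N).+1) tterm s i j (l%:Z - N%:Z) * dil (i + j) (gbin (M + N) l).
Proof.
rewrite -/(T M N); elim: M => [|M IHM].
  elim: N => [|N IHN].
    by rewrite /T /qp !big_ord0 big_ord1 G0 /tterm /texp /= !muln0 !mulr1.
  by rewrite qpS mulrA IHN stepN.
by rewrite qpS mulrAC IHM stepM.
Qed.

End FiniteJTP.

(** For [s * s = 1], the product side of Ramanujan's [f(s X^i, s X^j)]; the series side is
    [conv_theta]. *)
Definition theta (s : fps) (i j : nat) : fps :=
  etaq (i + j) * (qpi s i (i + j) * qpi s j (i + j)).

Lemma thetaC s i j : theta s i j = theta s j i.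
Proof. by rewrite /theta addnC [qpi s j _ * _]mulrC. Qed.

Lemma theta_coef0 s i j : (0 < i)%N -> (0 < j)%N -> theta s i j 0%N = 1.
Proof.
by move=> ip jp; rewrite /theta !fcoefM0 etaq_coef0 ?addn_gt0 ?ip // !qpi_coef0.
Qed.

(** In [finite_jtp], each Gaussian binomial times [etaq (i + j)] is close to one in the middle of
    the range, and near its ends the power of [X] is large. *)
Lemma conv_theta s i j : s * s = 1 -> (0 < i)%N -> (0 < j)%N ->
  conv (fun N => \sum_(l < (N + N).+1) tterm s i j (l%:Z - N%:Z)) (theta s i j).
Proof.
move=> ss ip jp; have kp : (0 < i + j)%N by lia.
apply: conv_approx (convM (conv_const (etaq (i + j)))
  (convM (@qpi_conv s i _ kp) (@qpi_conv s j _ kp))) => N.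
rewrite finite_jtp // mulr_sumr; apply: eqm_sum => -[l lt_l] _ /=.
have -> : etaq (i + j) = dil (i + j) (etaq 1) by rewrite dil_etaq // muln1.
rewrite mulrCA -dilM // /gbin -ltnS lt_l /tterm.
set z := l%:Z - N%:Z; set m := minn l (N + N - l).
have H : eqm m (etaq 1 * (qf (N + N) * qe l * qe (N + N - l))) 1.
  have E : etaq 1 * fpsV (etaq 1) = 1 by rewrite mulfVx // etaq_coef0.
  have -> : 1 = etaq 1 * (etaq 1 * fpsV (etaq 1) * fpsV (etaq 1)) by rewrite E mul1r E.
  apply: eqmM => //; apply: eqmM; first apply: eqmM.
  - by apply: (@eqmW _ (N + N)); [rewrite /m; lia|apply: qpi_eqm].
  - by refine (eqmW _ (@qe_eqm l)); rewrite /m; lia.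
  - by refine (eqmW _ (@qe_eqm (N + N - l))); lia.
have := dil_eqm kp H; rewrite dil1 // => {}H.
rewrite -[Y in eqm _ _ Y]mulr1 -!(mulrA (s ^+ absz z)).
(* Here [m + |z| = N] and [texp i j z >= |z|], so the precision is at least [N] for every [l]. *)
apply: eqmM => //; apply: (@eqmW _ (texp i j z + m)); last exact: (eqmXM H).
by have := texp_ge z ip jp; rewrite /m /z; lia.
Qed.

(** Without the term [z = N], of order at least [N], the number of terms is even, as the pairing in
    [psia_split] requires. *)
Lemma conv_theta_even s i j : s * s = 1 -> (0 < i)%N -> (0 < j)%N ->
  conv (fun N => \sum_(l < N + N) tterm s i j (l%:Z - N%:Z)) (theta s i j).
Proof.
move=> ss ip jp; apply: conv_approx (conv_theta ss ip jp) => N.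
rewrite big_ord_recr /= -[Y in eqm _ _ Y]addr0; apply: eqmD => //.
rewrite /tterm mulrC; apply: eqmXW; have := texp_ge ((N + N)%:Z - N%:Z) ip jp; lia.
Qed.

Lemma dil_sum d (I : Type) (r : seq I) (P : pred I) (F : I -> fps) :
  dil d (\sum_(i <- r | P i) F i) = \sum_(i <- r | P i) dil d (F i).
Proof.
by elim/big_rec2: _ => [|i y1 y2 _ <-]; rewrite ?dil0 ?dilD.
Qed.

Lemma dil_tterm d s i j z : (0 < d)%N -> dil d s = s ->
  dil d (tterm s i j z) = s ^+ absz z * X ^+ (d * texp i j z).
Proof. by move=> d_gt0 ds; rewrite /tterm dilM // dilX // ds dilXn. Qed.

(* In Ramanujan's notation: [phi(-x)], [psi(x)], [f(-x,-x^5)] and [f(x,x^2)]. *)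
Definition phi : fps := theta (-1) 1 1.
Definition psi : fps := theta 1 1 3.
Definition phib : fps := theta (-1) 1 5.
Definition psia : fps := theta 1 1 2.

(** * Dissections of the theta functions *)

Lemma sqrN1 : (-1 : fps) * -1 = 1. Proof. by ring. Qed.
Lemma dilN1 d : (0 < d)%N -> dil d (-1) = -1.
Proof. by move=> d_gt0; rewrite dilN dil1. Qed.

(** The exponent [z^2] is split by [z] modulo 3: multiples of 3 give [phi(-x^9)], and each of the
    classes [1] and [-1] gives [-x f(-x^3, -x^15)]. *)
Lemma phi_dissection : phi = dil 9 phi - X * dil 3 phib - X * dil 3 phib.
Proof.
have C i j : (0 < i)%N -> (0 < j)%N -> _ := conv_theta (i := i) (j := j) sqrN1.
(* The cut-off [3N + 1] makes the range consist of complete triples [3z - 1, 3z, 3z + 1] with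
   [|z| <= N]. *)
apply: (@conv_unique (fun N => \sum_(l < (3 * N + 1 + (3 * N + 1)).+1) tterm (-1) 1 1 (l%:Z - (3 * N + 1)%:Z))).
  apply: (conv_sub (k := fun N => (3 * N + 1)%N) _ (C 1%N 1%N _ _)) => // n; lia.
have E N : \sum_(l < (3 * N + 1 + (3 * N + 1)).+1) tterm (-1) 1 1 (l%:Z - (3 * N + 1)%:Z) =
  dil 9 (\sum_(l < (N + N).+1) tterm (-1) 1 1 (l%:Z - N%:Z)) +
  (- X) * dil 3 (\sum_(l < (N + N).+1) tterm (-1) 1 5 (l%:Z - N%:Z)) +
  (- X) * dil 3 (\sum_(l < (N + N).+1) tterm (-1) 5 1 (l%:Z - N%:Z)).
  have -> : ((3 * N + 1 + (3 * N + 1)).+1 = 3 * (N + N).+1)%N by lia.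
  rewrite (big_ord_mul _ _ _ (fun l => tterm (-1) 1 1 (l%:Z - (3 * N + 1)%:Z))).
  rewrite !dil_sum !mulr_sumr -!big_split; apply: eq_bigr => -[l _] _ /=.
  rewrite !big_ord_recl big_ord0 addr0 /= !dil_tterm ?dilN1 // /bump /=.
  set z := l%:Z - N%:Z.
  have -> : (3 * l + 0)%:Z - (3 * N + 1)%:Z = 3 * z - 1 by rewrite /z; lia.
  have -> : (3 * l + (1 + 0))%:Z - (3 * N + 1)%:Z = 3 * z by rewrite /z; lia.
  have -> : (3 * l + (1 + (1 + 0)))%:Z - (3 * N + 1)%:Z = 3 * z + 1 by rewrite /z; lia.
  have par (a b : int) : odd (absz a) = odd (absz b) -> (-1 : fps) ^+ absz a = (-1) ^+ absz b.
    by move=> Eab; rewrite -(signr_odd _ (absz a)) Eab signr_odd.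
  rewrite /tterm.
  have -> : (-1 : fps) ^+ absz (3 * z)%R = (-1) ^+ absz z by apply: par; lia.
  have -> : (-1 : fps) ^+ absz (3 * z + 1)%R = - (-1) ^+ absz z.
    by rewrite sgnD1 ?sqrN1 // mulN1r; congr (- _); apply: par; lia.
  have -> : (-1 : fps) ^+ absz (3 * z - 1)%R = - (-1) ^+ absz z.
    rewrite -[RHS]mulN1r -[RHS]sgnD1 ?sqrN1 //; apply: par; lia.
  have T1 := texpE 1 1 z; have T2 := texpE 1 5 z; have T3 := texpE 5 1 z.
  have -> : texp 1 1 (3 * z) = (9 * texp 1 1 z)%N by have := texpE 1 1 (3 * z); lia.
  have -> : texp 1 1 (3 * z + 1) = (1 + 3 * texp 5 1 z)%N by have := texpE 1 1 (3 * z + 1); lia.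
  have -> : texp 1 1 (3 * z - 1) = (1 + 3 * texp 1 5 z)%N by have := texpE 1 1 (3 * z - 1); lia.
  rewrite !exprD expr1; ring.
apply: (conv_ext (fun N => esym (E N))).
have -> : dil 9 phi - X * dil 3 phib - X * dil 3 phib =
  dil 9 phi + (- X) * dil 3 phib + (- X) * dil 3 (theta (-1) 5 1).
  by rewrite (thetaC _ 5 1) -/phib; ring.
apply: convD; first apply: convD.
- exact/conv_dil/C.
- by apply: convM; [exact: conv_const|exact/conv_dil/C].
- by apply: convM; [exact: conv_const|exact/conv_dil/C].
Qed.

(** Splitting by the parity of [z]. The two pieces are the ones that arise from the classes [0] and
    [-1] in [psi_dissection]. *)
Lemma psia_split : psia = theta 1 5 7 + X * theta 1 11 1.
Proof.
have C i j : (0 < i)%N -> (0 < j)%N -> _ := conv_theta_even (i := i) (j := j) (mulr1 (1 : fps)).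
apply: (@conv_unique (fun N => \sum_(l < (2 * N + 2 * N)) tterm 1 1 2 (l%:Z - (2 * N)%:Z))).
  apply: (conv_sub (k := fun N => (2 * N)%N) _ (C 1%N 2%N _ _)) => // n; lia.
have E N : \sum_(l < (2 * N + 2 * N)) tterm 1 1 2 (l%:Z - (2 * N)%:Z) =
  (\sum_(l < N + N) tterm 1 5 7 (l%:Z - N%:Z)) +
  X * (\sum_(l < N + N) tterm 1 11 1 (l%:Z - N%:Z)).
  have -> : (2 * N + 2 * N = 2 * (N + N))%N by lia.
  rewrite (big_ord_mul _ _ _ (fun l => tterm 1 1 2 (l%:Z - (2 * N)%:Z))).
  rewrite !mulr_sumr -!big_split; apply: eq_bigr => -[l _] _ /=.
  rewrite !big_ord_recl big_ord0 addr0 /= /bump /=.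
  set z := l%:Z - N%:Z.
  have -> : (2 * l + 0)%:Z - (2 * N)%:Z = 2 * z by rewrite /z; lia.
  have -> : (2 * l + (1 + 0))%:Z - (2 * N)%:Z = 2 * z + 1 by rewrite /z; lia.
  rewrite /tterm !expr1n !mul1r.
  have T1 := texpE 5 7 z; have T2 := texpE 11 1 z.
  have -> : texp 1 2 (2 * z) = (texp 5 7 z)%N by have := texpE 1 2 (2 * z); lia.
  have -> : texp 1 2 (2 * z + 1) = (1 + texp 11 1 z)%N by have := texpE 1 2 (2 * z + 1); lia.
  by rewrite exprD.
apply: (conv_ext (fun N => esym (E N))).
apply: convD; first exact: C.
by apply: convM; [exact: conv_const|exact: C].
Qed.

(** The class [3z + 1] yields [x psi(x^9)]; the other two classes are series in [x^3] and merge by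
    [psia_split]. *)
Lemma psi_dissection : psi = dil 3 psia + X * dil 9 psi.
Proof.
have dX : dil 3 X = X ^+ (3 * 1) by rewrite -(@dilXn 3 1).
rewrite psia_split dilD dilM // dX {dX}.
have C i j : (0 < i)%N -> (0 < j)%N -> _ := conv_theta (i := i) (j := j) (mulr1 (1 : fps)).
apply: (@conv_unique (fun N => \sum_(l < (3 * N + 1 + (3 * N + 1)).+1) tterm 1 1 3 (l%:Z - (3 * N + 1)%:Z))).
  apply: (conv_sub (k := fun N => (3 * N + 1)%N) _ (C 1%N 3%N _ _)) => // n; lia.
have E N : \sum_(l < (3 * N + 1 + (3 * N + 1)).+1) tterm 1 1 3 (l%:Z - (3 * N + 1)%:Z) =
  dil 3 (\sum_(l < (N + N).+1) tterm 1 5 7 (l%:Z - N%:Z)) +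
  X ^+ (3 * 1) * dil 3 (\sum_(l < (N + N).+1) tterm 1 1 11 (l%:Z - N%:Z)) +
  X * dil 9 (\sum_(l < (N + N).+1) tterm 1 3 1 (l%:Z - N%:Z)).
  have -> : ((3 * N + 1 + (3 * N + 1)).+1 = 3 * (N + N).+1)%N by lia.
  rewrite (big_ord_mul _ _ _ (fun l => tterm 1 1 3 (l%:Z - (3 * N + 1)%:Z))).
  rewrite !dil_sum !mulr_sumr -!big_split; apply: eq_bigr => -[l _] _ /=.
  rewrite !big_ord_recl big_ord0 addr0 /= !dil_tterm ?dil1 // /bump /=.
  set z := l%:Z - N%:Z.
  have -> : (3 * l + 0)%:Z - (3 * N + 1)%:Z = 3 * z - 1 by rewrite /z; lia.
  have -> : (3 * l + (1 + 0))%:Z - (3 * N + 1)%:Z = 3 * z by rewrite /z; lia.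
  have -> : (3 * l + (1 + (1 + 0)))%:Z - (3 * N + 1)%:Z = 3 * z + 1 by rewrite /z; lia.
  rewrite /tterm !expr1n !mul1r.
  have T1 := texpE 5 7 z; have T2 := texpE 1 11 z; have T3 := texpE 3 1 z.
  have -> : texp 1 3 (3 * z) = (3 * texp 5 7 z)%N by have := texpE 1 3 (3 * z); lia.
  have -> : texp 1 3 (3 * z + 1) = (1 + 9 * texp 3 1 z)%N by have := texpE 1 3 (3 * z + 1); lia.
  have -> : texp 1 3 (3 * z - 1) = (3 * 1 + 3 * texp 1 11 z)%N by have := texpE 1 3 (3 * z - 1); lia.
  rewrite !exprD expr1; ring.
apply: (conv_ext (fun N => esym (E N))).
rewrite (thetaC _ 11 1) /psi (thetaC _ 1 3).
apply: convD; first apply: convD.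
- exact/conv_dil/C.
- by apply: convM; [exact: conv_const|exact/conv_dil/C].
- by apply: convM; [exact: conv_const|exact/conv_dil/C].
Qed.

(** * Product formulas and the cubic norm *)

Lemma dil_dil d e f : (0 < d)%N -> (0 < e)%N -> dil d (dil e f) = dil (d * e) f.
Proof.
move=> dp ep; apply: fpsP => n /=.
case: (boolP (d %| n)%N) => [/dvdnP[m ->]|nd]; last first.
  case: ifP => // /dvdnP[k E]; case/negP: nd; apply/dvdnP; exists (k * e)%N; rewrite E; lia.
rewrite mulnK // [(d * e)%N]mulnC dvdn_pmul2r //; case: ifP => // /dvdnP[k ->].
by rewrite mulnK // -[(k * e * d)%N]mulnA mulnK // muln_gt0 ep.
Qed.

Lemma phiE : phi * etaq 2 = etaq 1 ^+ 2.
Proof. by rewrite -qpi_odd /phi /theta; ring. Qed.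

Lemma psiE : psi * etaq 1 = etaq 2 ^+ 2.
Proof.
have E1 : qpi 1 1 2 = qpi 1 1 4 * qpi 1 3 4.
  by rewrite (@qpi_split 2) // !big_ord_recl big_ord0 mulr1.
have E2 : qpi 1 1 2 * qpi (-1) 1 2 = qpi (-1) 2 4 by rewrite qpi_conj.
have E3 : qpi (-1) 2 4 * etaq 4 = etaq 2.
  by rewrite /etaq [RHS](@qpi_split 2) // !big_ord_recl big_ord0 mulr1.
rewrite -[in LHS]qpi_odd /psi /theta -E1.
transitivity (qpi 1 1 2 * qpi (-1) 1 2 * etaq 4 * etaq 2); first by ring.
by rewrite E2 E3; ring.
Qed.

(** Grouping factors modulo 3 completes the products to [(-X; X)_oo] and [(X; X^2)_oo]. The identity
    later evaluates the mixed terms in [sect_Wp]. *)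
Lemma psia_phib : psia * phib = dil 3 phi * dil 3 psi.
Proof.
have e0 d : (0 < d)%N -> etaq d 0%N = 1 := @etaq_coef0 d.
have P1 : dil 3 phi * etaq 6 = etaq 3 ^+ 2.
  by rewrite -[etaq 6](@dil_etaq 3 2) // -[etaq 3](@dil_etaq 3 1) // -dilM // phiE dilX.
have P2 : dil 3 psi * etaq 3 = etaq 6 ^+ 2.
  by rewrite -[etaq 6](@dil_etaq 3 2) // -[etaq 3](@dil_etaq 3 1) // -dilM // psiE dilX.
have A1 : qpi 1 1 1 = qpi 1 1 3 * qpi 1 2 3 * qpi 1 3 3.
  by rewrite (@qpi_split 3) // !big_ord_recl big_ord0 mulr1 mulrA.
have A2 : qpi 1 3 3 * etaq 3 = etaq 6 by rewrite /etaq qpi_conj.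
have B1 : qpi (-1) 1 2 = qpi (-1) 1 6 * qpi (-1) 3 6 * qpi (-1) 5 6.
  by rewrite (@qpi_split 3) // !big_ord_recl big_ord0 mulr1 mulrA.
have B2 : qpi (-1) 3 6 * etaq 6 = etaq 3.
  by rewrite /etaq [RHS](@qpi_split 2) // !big_ord_recl big_ord0 mulr1.
apply: (@mulfI1 (etaq 6 * etaq 3 * (etaq 1 * etaq 2))); first by rewrite !fcoefM0 !e0.
transitivity ((etaq 3 * etaq 6) ^+ 2 * (etaq 1 * etaq 2)); last first.
  transitivity ((dil 3 phi * etaq 6) * (dil 3 psi * etaq 3) * (etaq 1 * etaq 2)); last by ring.
  by rewrite P1 P2; ring.
transitivity (psia * phib * (qpi 1 3 3 * etaq 3) * (qpi (-1) 3 6 * etaq 6) * (etaq 1 * etaq 2)).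
  by rewrite A2 B2; ring.
rewrite /psia /phib /theta.
transitivity ((etaq 3 * etaq 6) ^+ 2 * ((qpi 1 1 3 * qpi 1 2 3 * qpi 1 3 3) * etaq 1) *
  ((qpi (-1) 1 6 * qpi (-1) 3 6 * qpi (-1) 5 6) * etaq 2)); first by ring.
by rewrite -A1 -B1 qpi_odd qpi_dist1; ring.
Qed.

(** * Sections modulo 3 and the cubic norm *)

Lemma sect3_Xn r j : (r < 3)%N ->
  sect 3 r (X ^+ j) = if (j %% 3 == r)%N then X ^+ (j %/ 3) else 0.
Proof.
move=> r3; apply: fpsP => n /=; rewrite fcoefXn; case: ifP => H; rewrite ?fcoefXn ?fcoef0.
  by congr (_%:R); congr nat_of_bool; apply/eqP/eqP; lia.
by case: eqP => // E; move: H; rewrite -E; lia.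
Qed.

Lemma sect3_XdilM r j f : (r < 3)%N ->
  sect 3 r (X ^+ j * dil 3 f) = f * sect 3 r (X ^+ j).
Proof. by move=> r3; rewrite mulrC sect_dilM. Qed.

Lemma sect3_comb f0 f1 f2 r : (r < 3)%N ->
  sect 3 r (dil 3 f0 + X * dil 3 f1 + X ^+ 2 * dil 3 f2) =
  [:: f0; f1; f2]`_r.
Proof.
move=> r3; rewrite -[dil 3 f0]mul1r -[1](expr0 X) -{2}(expr1 X) !sectD !sect3_XdilM // !sect3_Xn //.
by case: r r3 => [|[|[|//]]] _ /=; rewrite !(expr0, mulr0, mulr1, add0r, addr0).
Qed.

Lemma sect3_decomp f :
  f = dil 3 (sect 3 0 f) + X * dil 3 (sect 3 1 f) + X ^+ 2 * dil 3 (sect 3 2 f).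
Proof.
apply: (@sectP 3) => // r r3; rewrite sect3_comb //.
by case: r r3 => [|[|[|//]]].
Qed.

Lemma sect3M f g r : (r < 3)%N ->
  let F i := sect 3 i f in let G i := sect 3 i g in
  sect 3 r (f * g) =
  [:: F 0%N * G 0%N + X * (F 1%N * G 2%N + F 2%N * G 1%N);
      F 0%N * G 1%N + F 1%N * G 0%N + X * (F 2%N * G 2%N);
      F 0%N * G 2%N + F 1%N * G 1%N + F 2%N * G 0%N]`_r.
Proof.
move=> r3 F G; rewrite -sect3_comb //; congr (sect 3 r _).
rewrite {1}(sect3_decomp f) {1}(sect3_decomp g) -/(F 0%N) -/(F 1%N) -/(F 2%N)
  -/(G 0%N) -/(G 1%N) -/(G 2%N) !(dilD, dilM) //.
have -> : dil 3 X = X ^+ 3 by rewrite -[3%N]/(3 * 1)%N -(@dilXn 3 1).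
ring.
Qed.

(** The norm form of [f0 + f1 y + f2 y^2] for [y^3 = X]. *)
Definition nrm3 (f0 f1 f2 : fps) : fps :=
  f0 ^+ 3 + X * f1 ^+ 3 + X ^+ 2 * f2 ^+ 3 - X * (f0 * f1 * f2) *+ 3.

(* The product of [f(x)], [f(w x)] and [f(w^2 x)], [w] a primitive cube root of
   unity, written as a series in [x^3]. *)
Definition nrm (f : fps) : fps := nrm3 (sect 3 0 f) (sect 3 1 f) (sect 3 2 f).

Lemma nrmM f g : nrm (f * g) = nrm f * nrm g.
Proof. by rewrite /nrm !sect3M // /nrm3 /=; ring. Qed.

Lemma sect3_1 r : (r < 3)%N -> sect 3 r 1 = if r == 0%N then 1 else 0.
Proof. by move=> r3; rewrite -{1}(@dil1 3) // sect_dil. Qed.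

Lemma nrm1 : nrm 1 = 1.
Proof.
by rewrite /nrm !sect3_1 // /= /nrm3; ring.
Qed.

Lemma nrm_prod (I : Type) (s : seq I) (P : pred I) (F : I -> fps) :
  nrm (\prod_(i <- s | P i) F i) = \prod_(i <- s | P i) nrm (F i).
Proof. by elim/big_rec2: _ => [|i y1 y2 _ <-]; rewrite ?nrm1 ?nrmM. Qed.

Lemma sectN d r f : sect d r (- f) = - sect d r f.
Proof. by []. Qed.

(** The three conjugates of [1 - x^n] coincide if [3] divides [n]; otherwise their product is
    [1 - x^(3n)]. Then [x^3] is renamed to [X]. *)
Lemma nrm_1subX n :
  nrm (1 - X ^+ n) = if (3 %| n)%N then (1 - X ^+ (n %/ 3)) ^+ 3 else 1 - X ^+ n.
Proof.
rewrite /nrm !sectD !sectN !sect3_1 // !sect3_Xn //= [in X ^+ n](divn_eq n 3) /dvdn.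
set m := (n %/ 3)%N; have := ltn_pmod n (isT : (0 < 3)%N).
case: (n %% 3)%N => [|[|[|//]]] _ /=; rewrite /nrm3; first by ring.
  by rewrite exprD exprM; ring.
by rewrite exprD exprM; ring.
Qed.

Lemma conv_nrm s f : conv s f -> conv (fun n => nrm (s n)) (nrm f).
Proof.
move=> H; have C r : (r < 3)%N -> _ := fun r3 => conv_sect r3 H.
have C0 := C 0%N isT; have C1 := C 1%N isT; have C2 := C 2%N isT.
have E (g : fps) : nrm g = sect 3 0 g ^+ 3 + X * sect 3 1 g ^+ 3 + X ^+ 2 * sect 3 2 g ^+ 3 +
   (- (3%:R * X)) * (sect 3 0 g * sect 3 1 g * sect 3 2 g).
  by rewrite /nrm /nrm3; ring.
rewrite E; apply: (conv_ext (fun n => esym (E (s n)))).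
apply: convD.
  apply: convD; last by apply: convM; [exact: conv_const|exact: convX].
  by apply: convD; [exact: convX|apply: convM; [exact: conv_const|exact: convX]].
by apply: convM; [exact: conv_const|apply: convM => //; apply: convM].
Qed.

(** The factors of index divisible by 3 contribute [etaq d ^ 3]; the others are unchanged and
    contribute [etaq d / etaq (3 * d)]. *)
Lemma nrm_etaq d : (0 < d)%N -> ~~ (3 %| d)%N -> nrm (etaq d) * etaq (3 * d) = etaq d ^+ 4.
Proof.
move=> dp nd; have d3p : (0 < 3 * d)%N by rewrite muln_gt0.
have C := @qpi_conv (-1) d d dp; have C3 := @qpi_conv (-1) (3 * d) (3 * d) d3p.
have Cs : conv (fun n => qp (-1) d d (3 * n)) (etaq d).
  by apply: (conv_sub (k := fun n => (3 * n)%N) _ C) => n; lia.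
apply: (@conv_unique (fun n => nrm (qp (-1) d d (3 * n)) * qp (-1) (3 * d) (3 * d) n)).
  by apply: convM; first exact: conv_nrm.
have E n : nrm (qp (-1) d d (3 * n)) * qp (-1) (3 * d) (3 * d) n =
    qp (-1) d d (3 * n) * qp (-1) d d n ^+ 3.
  rewrite /qp nrm_prod.
  rewrite (big_ord_mul _ 3 n (fun m => nrm (1 + -1 * X ^+ (d + d * m)))).
  rewrite (big_ord_mul _ 3 n (fun m => 1 + -1 * X ^+ (d + d * m))).
  rewrite -prodrXl -!big_split; apply: eq_bigr => -[m _] _ /=.
  rewrite !big_ord_recl !big_ord0 /= /bump /= !mulN1r !nrm_1subX.
  have -> : (3 %| d + d * (3 * m + 0))%N = false.
    rewrite -[d in (d + _)%N]muln1 -mulnDr Euclid_dvdM // (negPf nd) /=; lia.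
  have -> : (3 %| d + d * (3 * m + (1 + 0)))%N = false.
    rewrite -[d in (d + _)%N]muln1 -mulnDr Euclid_dvdM // (negPf nd) /=; lia.
  have -> : (d + d * (3 * m + (1 + (1 + 0))) = 3 * (d + d * m))%N by lia.
  rewrite dvdn_mulr // mulKn //.
  have -> : (3 * d + 3 * d * m = 3 * (d + d * m))%N by lia.
  ring.
apply: (conv_ext (fun n => esym (E n))); rewrite exprS.
by apply: convM => //; apply: convX.
Qed.

Definition phi3 : fps := dil 3 phi.
Definition psi3 : fps := dil 3 psi.

Lemma phi_split : phi = dil 3 phi3 + X * dil 3 (- (phib + phib)) + X ^+ 2 * dil 3 0.
Proof.
rewrite {1}phi_dissection /phi3 dil_dil // dilN dilD dil0; ring.
Qed.

Lemma psi_split : psi = dil 3 psia + X * dil 3 psi3 + X ^+ 2 * dil 3 0.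
Proof. rewrite {1}psi_dissection /psi3 dil_dil // dil0; ring. Qed.

(** By the dissection of [phi], the second factor is [nrm phi], and [phi = etaq 1^2 / etaq 2]
    reduces it to norms of Euler products. *)
Lemma phi_nrm : phi3 * (phi3 ^+ 3 - (X * phib ^+ 3) *+ 8) = phi ^+ 4.
Proof.
have e0 d : (0 < d)%N -> etaq d 0%N = 1 := @etaq_coef0 d.
have -> : phi3 ^+ 3 - (X * phib ^+ 3) *+ 8 = nrm phi.
  rewrite /nrm phi_split !sect3_comb //= /nrm3; ring.
apply: (@mulfI1 (etaq 2 ^+ 4)); first by rewrite !exprS expr0 !fcoefM0 !e0.
have P1 : phi3 * etaq 6 = etaq 3 ^+ 2.
  by rewrite /phi3 -[etaq 6](@dil_etaq 3 2) // -[etaq 3](@dil_etaq 3 1) // -dilM // phiE dilX.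
have N1 : nrm (etaq 1) * etaq 3 = etaq 1 ^+ 4 by rewrite (@nrm_etaq 1).
have N2 : nrm (etaq 2) * etaq 6 = etaq 2 ^+ 4 by rewrite (@nrm_etaq 2).
have N3 : nrm phi * nrm (etaq 2) = nrm (etaq 1) ^+ 2 by rewrite -nrmM phiE expr2 nrmM.
transitivity ((phi3 * etaq 6) * (nrm phi * nrm (etaq 2))); first by rewrite -N2; ring.
rewrite P1 N3; transitivity ((nrm (etaq 1) * etaq 3) ^+ 2); first by ring.
rewrite N1; transitivity ((phi * etaq 2) ^+ 4); last by ring.
by rewrite phiE; ring.
Qed.

Lemma beta_even_phi : beta_even * phi = psi ^+ 2.
Proof.
have e0 d : (0 < d)%N -> etaq d 0%N = 1 := @etaq_coef0 d.
apply: (@mulfI1 (etaq 1 ^+ 2 * etaq 2)); first by rewrite !exprS expr0 !fcoefM0 !e0.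
transitivity (beta_even * (phi * etaq 2) * etaq 1 ^+ 2); first by ring.
transitivity ((psi * etaq 1) ^+ 2 * etaq 2); last by ring.
rewrite phiE psiE; transitivity (beta_even * etaq 1 ^+ 4); first by ring.
by rewrite beta_evenE; ring.
Qed.

(** * Sections of powers of the Hauptmodul *)

Lemma fcoefMz (z : int) (f : fps) n : (z%:~R * f) n = z * f n.
Proof.
rewrite mulrzl; have N m : (f *+ m) n = m%:Z * f n.
  elim: m => [|m IHm]; first by rewrite mulr0n mul0r.
  by rewrite mulrS fcoefD IHm intS mulrDl mul1r.
case: z => m; first by rewrite -pmulrn N.
by rewrite NegzE mulrNz fcoefN -pmulrn N mulNr.
Qed.

Lemma sectMz d r (z : int) f : sect d r (z%:~R * f) = z%:~R * sect d r f.
Proof. by apply: fpsP => n; rewrite fcoefMz /= -fcoefMz. Qed.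

Lemma dil_nat d n : (0 < d)%N -> dil d n%:R = n%:R.
Proof.
by move=> dp; elim: n => [|n IHn]; rewrite ?dil0 // -natr1 dilD IHn dil1.
Qed.

Definition iphi : fps := fpsV phi.
(** [tau] and [wphi] are the [t] and [w] of the overview. *)
Definition tau : fps := (phi3 * iphi) ^+ 4.
Definition wphi : fps := dil 3 phi3 * iphi.

Lemma phi_coef0 : phi 0%N = 1. Proof. exact: theta_coef0. Qed.
Lemma phi3_coef0 : phi3 0%N = 1. Proof. by rewrite dil_coef0 phi_coef0. Qed.
Lemma phiV : phi * iphi = 1. Proof. exact/mulfVx/phi_coef0. Qed.

Lemma fcoefX_0 (f : fps) n : f 0%N = 1 -> (f ^+ n) 0%N = 1.
Proof. by move=> f0; elim: n => // n IHn; rewrite exprS fcoefM0 f0 IHn. Qed.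

Lemma tau_phi : phi ^+ 4 * tau = phi3 ^+ 4.
Proof. by rewrite /tau -exprMn mulrCA phiV mulr1. Qed.

(** At [x^3] the norm identity reads [A^3 = t(x^3) (A^3 + (phi - A)^3)] with [A = phi(-x^9)],
    because [phi - A] is [-2x phib(x^3)]. Division by [phi^3] gives the cubic for [w = A / phi]. *)
Lemma wphi_cubic : wphi ^+ 3 = dil 3 tau * (3%:R * wphi ^+ 2 - 3%:R * wphi + 1).
Proof.
set A := dil 3 phi3; set B := dil 3 phib.
have E : tau * (phi3 ^+ 3 - (X * phib ^+ 3) *+ 8) = phi3 ^+ 3.
  apply: (mulfI1 phi3_coef0); rewrite mulrCA phi_nrm mulrC tau_phi; ring.
have {}E : dil 3 tau * (A ^+ 3 + (phi - A) ^+ 3) = A ^+ 3.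
  rewrite -[RHS](@dilX 3) // -[in RHS]E dilM //; congr (_ * _).
  rewrite dilD dilN -mulr_natr dilM // dilM // !dilX // -/A -/B.
  have -> : dil 3 8%:R = 8%:R by rewrite dil_nat.
  have -> : dil 3 X = X ^+ 3 by rewrite -[3%N]/(3 * 1)%N -(@dilXn 3 1).
  have -> : phi - A = - (X * (B + B)).
    by rewrite phi_split -/A dilN dilD dil0 -/B; ring.
  ring.
transitivity (A ^+ 3 * iphi ^+ 3); first by rewrite /wphi exprMn.
rewrite -E /wphi -/A.
transitivity (dil 3 tau * ((phi * iphi) ^+ 3 - 3%:R * A * iphi * (phi * iphi) ^+ 2 +
   3%:R * A ^+ 2 * iphi ^+ 2 * (phi * iphi))); first by ring.
by rewrite phiV; ring.
Qed.

(** * The cubic recurrence and its evaluation at [tau] *)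

Definition rec3_step (t : {poly int} * {poly int} * {poly int}) :=
  (t.1.2, t.2, 'X * (3%:R * t.2 - 3%:R * t.1.2 + t.1.1)).

(** Multiplying [wphi_cubic] by [w^n] and taking a section turns [t(x^3)] into [t], here the
    variable ['X]. *)
Definition rec3 (a b c : int) (n : nat) : {poly int} :=
  (iter n rec3_step (a%:P, b%:P, c%:P)).1.1.

Lemma rec3E a b c n :
  rec3 a b c n.+3 = 'X * (3%:R * rec3 a b c n.+2 - 3%:R * rec3 a b c n.+1 + rec3 a b c n).
Proof. by rewrite /rec3 !iterS; case: (iter n _ _) => [[x y] z]. Qed.

Lemma ind3 (P : nat -> Prop) :
  P 0%N -> P 1%N -> P 2%N -> (forall n, P n -> P n.+1 -> P n.+2 -> P n.+3) ->
  forall n, P n.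
Proof.
move=> P0 P1 P2 PS n; suff : [/\ P n, P n.+1 & P n.+2] by case.
by elim: n => [|n [H0 H1 H2]]; split=> //; apply: PS.
Qed.

Definition ev (p : {poly int}) : fps := (map_poly intr p).[tau].

Lemma evM p q : ev (p * q) = ev p * ev q.
Proof. by rewrite /ev rmorphM hornerM. Qed.
Lemma evD p q : ev (p + q) = ev p + ev q.
Proof. by rewrite /ev rmorphD hornerD. Qed.
Lemma evN p : ev (- p) = - ev p.
Proof. by rewrite /ev rmorphN hornerN. Qed.
Lemma evC (a : int) : ev a%:P = a%:~R.
Proof. by rewrite /ev map_polyC hornerC. Qed.
Lemma evX : ev 'X = tau.
Proof. by rewrite /ev map_polyX hornerX. Qed.
Lemma evXn n : ev 'X^n = tau ^+ n.
Proof. by rewrite /ev map_polyXn hornerXn. Qed.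
Lemma ev_natr n : ev n%:R = n%:R.
Proof. by rewrite /ev rmorph_nat -polyC_natr hornerC. Qed.
Lemma evE p : ev p = \sum_(i < size p) (p`_i)%:~R * tau ^+ i.
Proof.
rewrite /ev (@horner_coef_wide _ (size p)); last exact: size_poly.
by apply: eq_bigr => i _; rewrite coef_map.
Qed.

(** The recurrence starts at [k = -2], where the sections of [H phi^2], [H phi] and [H] supply the
    initial values; this explains the shift [k.+2]. *)
Lemma sect_rec3 (H K : fps) r a b c : (r < 3)%N ->
  sect 3 r (H * phi ^+ 2) = phi3 ^+ 2 * K * a%:~R ->
  sect 3 r (H * phi) * phi3 = phi3 ^+ 2 * K * b%:~R ->
  sect 3 r H = K * c%:~R ->
  forall k, sect 3 r (H * wphi ^+ k) = K * ev (rec3 a b c k.+2).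
Proof.
move=> r3 Ha Hb Hc.
have E k : sect 3 r (H * phi ^+ 2 * wphi ^+ k) = phi3 ^+ 2 * K * ev (rec3 a b c k).
  elim/ind3: k => [|||k H0 H1 H2].
  - by rewrite mulr1 evC.
  - rewrite evC -Hb [RHS]mulrC -sect_dilM //; congr (sect 3 r _).
    rewrite expr1 /wphi; transitivity (dil 3 phi3 * (H * phi) * (phi * iphi)); first by ring.
    by rewrite phiV mulr1.
  - rewrite evC -[RHS]mulrA -Hc -sect_dilM // dilX //; congr (sect 3 r _).
    rewrite /wphi; transitivity (dil 3 phi3 ^+ 2 * H * (phi * iphi) ^+ 2); first by ring.
    by rewrite phiV; ring.
  have -> : H * phi ^+ 2 * wphi ^+ k.+3 = dil 3 tau * (3%:~R * (H * phi ^+ 2 * wphi ^+ k.+2) +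
      (-3)%:~R * (H * phi ^+ 2 * wphi ^+ k.+1) + H * phi ^+ 2 * wphi ^+ k).
    have e m : wphi ^+ (m + k) = wphi ^+ k * wphi ^+ m by rewrite addnC exprD.
    by rewrite (e 3%N) (e 2%N) (e 1%N) wphi_cubic; ring.
  rewrite sect_dilM // !sectD !sectMz H0 H1 H2 rec3E evM evX !evD evN !evM !ev_natr.
  ring.
move=> k; apply: (@mulfI1 (phi3 ^+ 2)); first by apply/fcoefX_0/phi3_coef0.
rewrite mulrA -E -sect_dilM // dilX //; congr (sect 3 r _).
have -> : wphi ^+ k.+2 = wphi ^+ k * wphi ^+ 2 by rewrite -exprD addn2.
rewrite {3}/wphi; transitivity (dil 3 phi3 ^+ 2 * H * wphi ^+ k * (phi * iphi) ^+ 2).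
  by rewrite phiV; ring.
ring.
Qed.

Definition Wp := rec3 (-3) (-3) 1.
Definition Sp := rec3 1 1 1.

Lemma sect_phi : [/\ sect 3 0 phi = phi3, sect 3 1 phi = - (phib + phib) & sect 3 2 phi = 0].
Proof. by split; rewrite phi_split sect3_comb. Qed.

Lemma sect_psi : [/\ sect 3 0 psi = psia, sect 3 1 psi = psi3 & sect 3 2 psi = 0].
Proof. by split; rewrite psi_split sect3_comb. Qed.

Lemma sect3_sqr_0 (f : fps) : sect 3 2 f = 0 -> sect 3 0 (f ^+ 2) = sect 3 0 f ^+ 2.
Proof. by move=> f2; rewrite expr2 sect3M //= f2; ring. Qed.

Lemma sect3_sqr_2 (f : fps) : sect 3 2 f = 0 -> sect 3 2 (f ^+ 2) = sect 3 1 f ^+ 2.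
Proof. by move=> f2; rewrite expr2 sect3M //= f2; ring. Qed.

Lemma sect3_sqrM_2 (f g : fps) : sect 3 2 f = 0 -> sect 3 2 g = 0 ->
  sect 3 2 (f ^+ 2 * g) =
  sect 3 0 f * sect 3 1 f * sect 3 1 g *+ 2 + sect 3 1 f ^+ 2 * sect 3 0 g.
Proof. by move=> f2 g2; rewrite expr2 !sect3M //= f2 g2; ring. Qed.

Lemma sect3_sqrM_sqr_2 (f g : fps) : sect 3 2 f = 0 -> sect 3 2 g = 0 ->
  sect 3 2 (f ^+ 2 * g ^+ 2) = (sect 3 0 f * sect 3 1 g) ^+ 2 +
  (sect 3 0 f * sect 3 1 g) * (sect 3 1 f * sect 3 0 g) *+ 4 + (sect 3 1 f * sect 3 0 g) ^+ 2.
Proof. by move=> f2 g2; rewrite !expr2 !sect3M //= f2 g2; ring. Qed.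

Lemma sect_Sp k : sect 3 0 (wphi ^+ k) = ev (Sp k.+2).
Proof.
have [f0 f1 f2] := sect_phi.
rewrite -[wphi ^+ k]mul1r -[RHS]mul1r; apply: sect_rec3 => //.
- by rewrite mul1r sect3_sqr_0 // f0 !mulr1.
- by rewrite mul1r f0 !mulr1.
- by rewrite sect3_1 // mulr1.
Qed.

Lemma sect_Wp k : sect 3 2 (psi ^+ 2 * wphi ^+ k) = psi3 ^+ 2 * ev (Wp k.+2).
Proof.
have pb : psia * phib = phi3 * psi3 := psia_phib.
have [f0 f1 f2] := sect_phi; have [g0 g1 g2] := sect_psi.
apply: sect_rec3 => //.
(* In units of [(phi3 * psi3)^2] the three terms are [4 - 8 + 1 = -3], by [pb]; the next initial
   value is [-4 + 1 = -3]. *)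
- rewrite sect3_sqrM_sqr_2 // f0 f1 g0 g1 mulrN mulrDr pb; ring.
- rewrite sect3_sqrM_2 // f0 f1 g0 g1.
  transitivity ((- 4%:R * (psia * phib) * psi3 + psi3 ^+ 2 * phi3) * phi3); first by ring.
  by rewrite pb; ring.
- by rewrite sect3_sqr_2 // g1 mulr1.
Qed.

(** * Vanishing and 3-adic valuations of the coefficients *)

Lemma rec3_coef_low a b c n j : (3 * j + 2 < n)%N -> (rec3 a b c n)`_j = 0.
Proof.
elim/ind3: n j => [|||n H0 H1 H2] j; try lia.
rewrite rec3E coefXM; case: j => [|j] //= lt_j.
rewrite coefD coefB !mulr_natl !coefMn H0 ?H1 ?H2 //; lia.
Qed.

Lemma rec3_coef0 a b c n : (rec3 a b c n.+3)`_0 = 0.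
Proof. by rewrite rec3E coefXM. Qed.

Lemma rec3_coefS a b c n j : (rec3 a b c n.+3)`_j.+1 =
  3 * (rec3 a b c n.+2)`_j - 3 * (rec3 a b c n.+1)`_j + (rec3 a b c n)`_j.
Proof. by rewrite rec3E coefXM /= coefD coefB !mulr_natl !coefMn. Qed.

Lemma pow3_dvd_mul e1 e2 e (x y : int) : (e <= e1 + e2)%N ->
  ((3 ^ e1)%:Z %| x)%Z -> ((3 ^ e2)%:Z %| y)%Z -> ((3 ^ e)%:Z %| x * y)%Z.
Proof.
move=> le_e dx dy; apply: (@dvdz_trans ((3 ^ e1)%:Z * (3 ^ e2)%:Z)); last exact: dvdz_mul.
by rewrite -PoszM -expnD dvdzE /= dvdn_exp2l.
Qed.

Lemma pow3_dvdW e e' (x : int) : (e <= e')%N ->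
  ((3 ^ e')%:Z %| x)%Z -> ((3 ^ e)%:Z %| x)%Z.
Proof.
by move=> le_e; apply: dvdz_trans; rewrite dvdzE /= dvdn_exp2l.
Qed.

(** A full step raises [j] by one and [n] by three and so preserves the exponent. The two nearer
    terms fall short by at most one, which their coefficient 3 restores. The offset [o] encodes the
    divisibility of the initial values. *)
Lemma rec3_coef_dvd a b c o :
  ((3 ^ (o./2))%:Z %| a)%Z -> ((3 ^ ((o - 1)./2))%:Z %| b)%Z -> ((3 ^ ((o - 2)./2))%:Z %| c)%Z ->
  forall n j, ((3 ^ ((3 * j + o - n)./2))%:Z %| (rec3 a b c n)`_j)%Z.
Proof.
move=> da db dc n.
have base (x : int) m : ((3 ^ ((o - m)./2))%:Z %| x)%Z ->
    forall j, ((3 ^ ((3 * j + o - m)./2))%:Z %| x%:P`_j)%Z.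
  by move=> dx j; rewrite coefC; case: eqP => [->|_]; rewrite ?muln0 ?add0n ?dvdz0.
elim/ind3: n => [|||n H0 H1 H2] j.
- by apply: base; rewrite subn0.
- exact: base.
- exact: base.
case: j => [|j]; first by rewrite rec3_coef0 dvdz0.
have d3 : ((3 ^ 1)%:Z %| 3)%Z by [].
rewrite rec3_coefS; apply: rpredD; first apply: rpredB.
- by refine (pow3_dvd_mul _ d3 (H2 j)); clear; lia.
- by refine (pow3_dvd_mul _ d3 (H1 j)); clear; lia.
- by refine (pow3_dvdW _ (H0 j)); clear; lia.
Qed.

(** The multipliers in [U_2 (E t^i) = E(x^3) Ap_i(t)] and [U_0 (E(x^3) t^i) = E Bp_i(t)]. The
    recurrence yields them times [t^i], which is divided out. *)
Definition Ap i := drop_poly i (Wp (4 * i + 3)).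
Definition Bp i := drop_poly i (Sp (4 * i + 2)).

Lemma drop_polyK (p : {poly int}) i : (forall j, (j < i)%N -> p`_j = 0) ->
  drop_poly i p * 'X^i = p.
Proof.
move=> H; rewrite -[RHS](poly_take_drop i p) [take_poly i p](_ : _ = 0) ?add0r //.
by apply/polyP => j; rewrite coef_take_poly coef0; case: ifP => // /H.
Qed.

Lemma Ap_coef0 i : (Ap i)`_0 = 0.
Proof. by rewrite coef_drop_poly rec3_coef_low //; lia. Qed.

Lemma Bp_coef0 i : (0 < i)%N -> (Bp i)`_0 = 0.
Proof. by move=> ip; rewrite coef_drop_poly rec3_coef_low //; lia. Qed.

Lemma Ap_dvd i j : ((3 ^ ((3 * j - i)./2))%:Z %| (Ap i)`_j)%Z.
Proof.
rewrite coef_drop_poly.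
(* Offset 3 demands the divisors 3, 3, 1 of the initial values [-3, -3, 1]; at index [j + i] the
   exponent becomes half of [3j - i]. *)
have H := @rec3_coef_dvd (-3) (-3) 1 3 isT isT isT (4 * i + 3) (j + i).
by refine (pow3_dvdW _ H); clear; lia.
Qed.

Lemma Bp_dvd i j : ((3 ^ ((3 * j - i - 1)./2))%:Z %| (Bp i)`_j)%Z.
Proof.
rewrite coef_drop_poly.
have H := @rec3_coef_dvd 1 1 1 1 isT isT isT (4 * i + 2) (j + i).
by refine (pow3_dvdW _ H); clear; lia.
Qed.

(** This and the next two values are divisible by 9 where the general bounds guarantee only 3. *)
Lemma Ap01 : (Ap 0)`_1 = 9.
Proof. by rewrite coef_drop_poly /= !rec3_coefS !coefC. Qed.

Lemma Ap11 : (Ap 1)`_1 = -9.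
Proof. by rewrite coef_drop_poly /= !(rec3_coefS, rec3_coef0) !coefC. Qed.

Lemma Bp22 : (Bp 2)`_2 = 306.
Proof. by rewrite coef_drop_poly /= !(rec3_coefS, rec3_coef0) !coefC. Qed.

(** * The 3-adic induction *)

Lemma beta_even_phi3 : dil 3 beta_even * phi3 = psi3 ^+ 2.
Proof. by rewrite -dilM // beta_even_phi dilX. Qed.

Lemma tau_powE i : tau ^+ i * phi ^+ (4 * i) = phi3 ^+ (4 * i).
Proof. by rewrite !exprM -exprMn -tau_phi [_ * tau]mulrC. Qed.

Lemma tau_pow_iphi i : tau ^+ i = phi3 ^+ (4 * i) * iphi ^+ (4 * i).
Proof. by rewrite /tau -exprM exprMn. Qed.

(** Since [E t^i = psi^2 phi3^(4i) / phi^(4i+1)], multiplication by [phi(-x^9)^(4i+1)] leaves a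
    series in [x^3] times [psi^2 w^(4i+1)]. *)
Lemma sect_even i : sect 3 2 (beta_even * tau ^+ i) = dil 3 beta_even * ev (Ap i).
Proof.
have c0 n : (phi3 ^+ n) 0%N = 1 by apply/fcoefX_0/phi3_coef0.
have ApE : ev (Wp (4 * i + 3)) = ev (Ap i) * tau ^+ i.
  rewrite -evXn -evM drop_polyK // => j lt_j.
  by rewrite rec3_coef_low //; lia.
have bE : beta_even = psi ^+ 2 * iphi by rewrite -beta_even_phi -mulrA phiV mulr1.
apply: (mulfI1 (c0 (4 * i + 1)%N)); rewrite -sect_dilM // dilX //.
have -> : dil 3 phi3 ^+ (4 * i + 1) * (beta_even * tau ^+ i) =
   dil 3 (phi ^+ (4 * i)) * (psi ^+ 2 * wphi ^+ (4 * i + 1)).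
  by rewrite dilX // -/phi3 bE tau_pow_iphi /wphi (exprMn _ (dil 3 phi3)) !(exprD _ (4 * i) 1); ring.
rewrite sect_dilM // sect_Wp.
have -> : (4 * i + 1).+2 = (4 * i + 3)%N by lia.
rewrite ApE -beta_even_phi3 exprD -tau_powE; ring.
Qed.

Lemma sect_odd i : sect 3 0 (dil 3 beta_even * tau ^+ i) = beta_even * ev (Bp i).
Proof.
have c0 n : (phi3 ^+ n) 0%N = 1 by apply/fcoefX_0/phi3_coef0.
have BpE : ev (Sp (4 * i + 2)) = ev (Bp i) * tau ^+ i.
  rewrite -evXn -evM drop_polyK // => j lt_j.
  by rewrite rec3_coef_low //; lia.
rewrite sect_dilM //; congr (_ * _).
apply: (mulfI1 (c0 (4 * i)%N)); rewrite -sect_dilM // dilX //.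
have -> : dil 3 phi3 ^+ (4 * i) * tau ^+ i = dil 3 (phi ^+ (4 * i)) * wphi ^+ (4 * i).
  by rewrite dilX // -/phi3 tau_pow_iphi /wphi (exprMn _ (dil 3 phi3)); ring.
rewrite sect_dilM // sect_Sp.
have -> : (4 * i).+2 = (4 * i + 2)%N by lia.
rewrite BpE -tau_powE; ring.
Qed.

Lemma sect_evM r (F G : fps) (P : nat -> {poly int}) :
  (forall i, sect 3 r (F * tau ^+ i) = G * ev (P i)) ->
  forall p : {poly int},
  sect 3 r (F * ev p) = G * ev (\sum_(i < size p) p`_i *: P i).
Proof.
move=> H p; rewrite evE mulr_sumr sect_sum.
have -> : ev (\sum_(i < size p) p`_i *: P i) = \sum_(i < size p) (p`_i)%:~R * ev (P i).
  elim/big_rec2: _ => [|i y1 y2 _ <-]; first by rewrite -polyC0 evC.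
  by rewrite evD -mul_polyC evM evC.
rewrite mulr_sumr; apply: eq_bigr => i _.
by rewrite mulrCA sectMz H mulrCA.
Qed.

(* The exponents are chosen to be stable under both transitions.  Truncated
   subtraction makes the first one vanish at [j = 1]; the value [2] at [j = 2] in
   [even_state] is what compensates the weak bound [Ap_dvd] on the coefficients of [Ap 2]. *)
Definition odd_state (a : nat) (p : {poly int}) :=
  p`_0 = 0 /\ forall j, (0 < j)%N -> ((3 ^ (2 * a + (3 * j - 5)./2))%:Z %| p`_j)%Z.

Definition even_state (a : nat) (p : {poly int}) :=
  p`_0 = 0 /\ forall j, (0 < j)%N ->
    ((3 ^ (2 * a + (if j == 2 then 2 else (3 * j - 3)./2)%N))%:Z %| p`_j)%Z.

Lemma odd_to_even a p : odd_state a p -> even_state a (\sum_(i < size p) p`_i *: Bp i).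
Proof.
move=> [p0 dp]; split=> [|j jp]; rewrite coef_sum.
  rewrite big1 // => -[[|i] _] _ /=; rewrite coefZ; first by rewrite p0 mul0r.
  by rewrite Bp_coef0 ?mulr0.
apply: rpred_sum => -[[|i] _] _ /=; rewrite coefZ; first by rewrite p0 mul0r dvdz0.
(* For [p_2] and [Bp 2] at [j = 2], the general bounds add up to only [2a + 1]; 306 supplies the
   missing factor. *)
case: (boolP ((i == 1%N) && (j == 2%N))) => [/andP[/eqP -> /eqP ->]|ne].
  rewrite Bp22; refine (pow3_dvd_mul (e1 := 2 * a) (e2 := 2) _ _ _) => //.
  by refine (pow3_dvdW _ (dp 2%N _)); lia.
refine (pow3_dvd_mul _ (dp i.+1 _) (Bp_dvd i.+1 j)) => //.
by clear dp p0; case: (j =P 2%N) ne => [->|nj]; rewrite ?andbT; [move=> /eqP ne|move=> _] => /=; lia.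
Qed.

Lemma even_to_odd a p : even_state a p -> odd_state a.+1 (\sum_(i < size p) p`_i *: Ap i).
Proof.
move=> [p0 dp]; split=> [|j jp]; rewrite coef_sum.
  by rewrite big1 // => i _; rewrite coefZ Ap_coef0 mulr0.
apply: rpred_sum => -[[|i] _] _ /=; rewrite coefZ; first by rewrite p0 mul0r dvdz0.
(* For [p_1] and [Ap 1] at [j = 1], the general bounds give [2a + 1] where [2a + 2] is required; the
   value [-9] closes the gap. *)
case: (boolP ((i == 0%N) && (j == 1%N))) => [/andP[/eqP -> /eqP ->]|ne].
  rewrite Ap11; refine (pow3_dvd_mul (e1 := 2 * a) (e2 := 2) _ _ _) => //; first by lia.
  by refine (pow3_dvdW _ (dp 1%N _)); lia.
refine (pow3_dvd_mul _ (dp i.+1 _) (Ap_dvd i.+1 j)) => //.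
by clear dp p0; move: ne; rewrite negb_and => /orP ne; case: eqP => Ei; lia.
Qed.

(** The series [U_2 (U_0 U_2)^a E] of the overview. *)
Fixpoint odd_iter (a : nat) : fps :=
  if a is a'.+1 then sect 3 2 (sect 3 0 (odd_iter a')) else sect 3 2 beta_even.

Lemma odd_iterE a : exists2 p, odd_state a.+1 p & odd_iter a = dil 3 beta_even * ev p.
Proof.
elim: a => [|a [p dp E]] /=.
  exists (Ap 0); last by rewrite -sect_even expr0 mulr1.
  split=> [|j jp]; first exact: Ap_coef0.
  (* The required exponent is [2 + (3j - 5)/2]; [Ap_dvd] reaches it for [j > 1], and [j = 1] needs
     the exact value 9. *)
  case: (ltngtP j 1) jp => [|j_gt1|->] // _; last by rewrite Ap01.
  by refine (pow3_dvdW _ (Ap_dvd 0 j)); lia.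
exists (\sum_(i < size (\sum_(i < size p) p`_i *: Bp i)%R) (\sum_(i < size p) p`_i *: Bp i)`_i *: Ap i).
  by apply: even_to_odd; apply: odd_to_even.
by rewrite E (sect_evM sect_odd) (sect_evM sect_even).
Qed.

Lemma odd_iter_coef a t n : (4 * t + 1 = 9 ^ a.+1)%N ->
  odd_iter a n = frak_b (2 * (3 ^ (2 * a + 1) * n + t)).
Proof.
elim: a t n => [|a IHa] t n Et /=.
  by congr (frak_b (2 * _)); rewrite expn1 in Et; lia.
have E9 : (9 ^ a.+2 = 9 * 9 ^ a.+1)%N by rewrite expnS.
have E3 : (3 ^ (2 * a + 1) * 3 = 9 ^ a.+1)%N.
  by rewrite -expnSr (_ : (2 * a + 1).+1 = 2 * a.+1)%N ?expnM //; lia.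
have E3' : (3 ^ (2 * a.+1 + 1) = 9 * 3 ^ (2 * a + 1))%N.
  by rewrite (_ : (2 * a.+1 + 1 = 2 + (2 * a + 1))%N) ?expnD //; lia.
(* The new index is [9n + 6], and [6 * 3^(2a+1) = 2 * 9^(a+1)] is the part of [t] that it accounts
   for. *)
rewrite (IHa (t - 2 * 9 ^ a.+1)%N); last by lia.
rewrite E3'; congr (frak_b (2 * _)); move: E3 E9 Et; move: (3 ^ (2 * a + 1))%N (9 ^ a.+1)%N => x y; nia.
Qed.

Theorem theorem1p1 (alpha n : nat) : (1 <= alpha)%N ->
  ((3 ^ (2 * alpha))%:Z %|
     frak_b (2 * 3 ^ (2 * alpha - 1) * n + (3 ^ (2 * alpha) - 1) %/ 2))%Z.
Proof.
case: alpha => // a _.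
(* Here [t = (9^(a+1) - 1)/4], so that [2t] is the constant [(3^(2 alpha) - 1)/2] of the
   progression. *)
have [t Et] : exists t, (4 * t + 1 = 9 ^ a.+1)%N.
  elim: a => [|a [t Et]]; first by exists 2%N.
  by exists (9 * t + 2)%N; rewrite [RHS]expnS -Et; lia.
have [p [p0 dp] E] := odd_iterE a.
have -> : (2 * 3 ^ (2 * a.+1 - 1) * n + (3 ^ (2 * a.+1) - 1) %/ 2 =
    2 * (3 ^ (2 * a + 1) * n + t))%N.
  have -> : (2 * a.+1 - 1 = 2 * a + 1)%N by lia.
  rewrite expnM -[(3 ^ 2)%N]/9%N -Et mulnDr mulnA; congr (_ + _)%N; lia.
rewrite -(odd_iter_coef n Et) E evE mulr_sumr fcoef_sum.
apply: rpred_sum => k _; rewrite mulrCA fcoefMz; apply: dvdz_mulr.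
case: k => -[|i] _ /=; first by rewrite p0 dvdz0.
by refine (pow3_dvdW _ (dp i.+1 _)) => //; lia.
Qed.
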